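(* Fix a positive integer $k$. Let $(P_m)_{m\ge1}$ be a sequence of finite posets and put $n_m=|P_m|$. Suppose that one of the following holds: (a) $n_m\to\infty$ and $|\min(P_m)|/\log n_m\to\infty$; (b) $\min_{x\in P_m} h(x)\to\infty$; (c) $n_m\to\infty$ and there is a fixed $c>0$ with $w(P_m)\ge c\,n_m$ for all $m$. Then $\delta_k(P_m)\to 1/k!$.
   Context: For a finite poset $P$ with $n$ elements, a linear extension is an order-preserving bijection $f:P\to\{1,\dots,n\}$; let $f$ be a uniformly random linear extension and $\sigma$ the corresponding uniformly random linear ordering of $P$. The average height of $x$ is $h(x)=\mathbb{E}f(x)$. $\min(P)$ is the set of minimal elements, and the width $w(P)$ is the maximum size of an antichain. For $X\subseteq P$, $\delta_k(X)$ is the largest $\delta$ for which there is $Y\subseteq X$ with $|Y|=k$ such that the restriction $\sigma|_Y$ (the induced ordering of $Y$) takes each of its $k!$ possible values with probability at least $\delta$. *)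

(* Defs.v *)
From HB Require Import structures.
From mathcomp Require Import all_boot all_order all_algebra.
From mathcomp Require Import all_classical all_reals all_analysis.

Set Implicit Arguments.
Unset Strict Implicit.
Unset Printing Implicit Defensive.

Import Order.TTheory GRing.Theory Num.Theory.
Import numFieldNormedType.Exports.

Local Open Scope ring_scope.

Section Posets.
Context {d : Order.disp_t} (P : finPOrderType d).

Definition min_elts : {set P} := [set x | [forall y, ~~ (y < x)%O]]%SET.

Definition antichain (A : {set P}) : bool :=
  [forall x in A, forall y in A, (x != y) ==> (x >< y)%O].

Definition width : nat := \max_(A : {set P} | antichain A) #|A|.

(* Positions are numbered from 0, so the position of x in {1, ..., n} is
   (f x).+1.  An injection P -> 'I_#|P| is a bijection by cardinality. *)
Definition linear_extensions : {set {ffun P -> 'I_#|P|}} :=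
  [set f : {ffun P -> 'I_#|P|} | injectiveb f &&
     [forall x, forall y, (x <= y)%O ==> (f x <= f y)%N]]%SET.

Definition ordering (f : {ffun P -> 'I_#|P|}) : seq P :=
  sort (fun x y => (f x <= f y)%N) (enum P).

Definition restricted_ordering (f : {ffun P -> 'I_#|P|}) (Y : {set P}) : seq P :=
  [seq x <- ordering f | x \in Y].

Context (R : realType).

Definition linext_prob (E : pred {ffun P -> 'I_#|P|}) : R :=
  #|[set f in linear_extensions | E f]%SET|%:R / #|linear_extensions|%:R.

Definition height (x : P) : R :=
  (\sum_(f in linear_extensions) (f x).+1%:R) / #|linear_extensions|%:R.

(* Every height is at most #|P|, so the default value #|P| is harmless when P
   is nonempty, and it gives the value 0 to the empty poset. *)
Definition min_height : R := \big[Order.min/#|P|%:R]_(x : P) height x.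

(* The possible values of the restriction to Y are the k! sequences
   enumerating Y without repetition. *)
Definition delta_witness (k : nat) (X : {set P}) (delta : R) : Prop :=
  exists Y : {set P}, [/\ Y \subset X, #|Y| = k &
    forall t : seq P, perm_eq t (enum Y) ->
      delta <= linext_prob (fun f => restricted_ordering f Y == t)].

(* For k <= #|X| the supremum is attained; it is 0, the supremum of the
   empty set, when k > #|X|. *)
Definition delta_ (k : nat) (X : {set P}) : R :=
  sup [set delta | delta_witness k X delta]%classic.

End Posets.

(* Main.v *)
Require Import Defs.
From mathcomp Require Import all_boot all_order all_algebra.
From mathcomp Require Import ring lra zify.
From mathcomp Require Import reals.

Set Implicit Arguments.
Unset Strict Implicit.
Unset Printing Implicit Defensive.

Import Order.TTheory GRing.Theory Num.Theory.

Local Open Scope ring_scope.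

(** Replace the uniform linear extension by a uniform order-preserving map
    z : P -> {0, ..., N} with N huge: z is injective with high probability, and
    then its ranks form a uniform linear extension, independent of the image.

    Let X_v be the coarse position of z_v, i.e. the bin of a bounded partition
    of the chain that contains it.  By Ramsey's theorem a long sequence of
    elements has a subsequence all of whose k-element subsequences have almost
    the same law for X; averaging over blocks shows that such a law is almost
    exchangeable, as in the Ryll-Nardzewski theorem.  If the bins of distinct
    elements rarely coincide, all k! orderings are thus almost equally likely.

    The bin of z_x is unlikely to be that of z_y as soon as the interval of
    values allowed for z_x by the other coordinates is usually much longer than
    a bin.  For minimal x this interval contains [0, z_x], and the four
    functions theorem makes t |-> P(z_x >= t) submultiplicative, so that z_x is
    of the order of its median ("scale").  It remains to find many minimal
    elements of comparable scale: in (a) the scales fall in O(log n) dyadic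
    classes; in (b) all scales are large compared with the typical value of
    min z, which forces some dyadic class to be large.  In (c), counting shows
    that most elements of a linear-size antichain have an allowed interval of
    length proportional to N. *)

(** * Ramsey's theorem for subsequences *)

Section Ramsey.
Local Open Scope nat_scope.

(** Halfway stage of Ramsey's theorem: the colour of a [k.+1]-subsequence depends only on its first
    element, next to which it is recorded. *)
Fixpoint end_homogeneous (T C : eqType) (k : nat) (col : seq T -> C)
    (v : seq (T * C)) : Prop :=
  if v is p :: v' then
    (forall u, subseq u (unzip1 v') -> size u = k -> col (p.1 :: u) = p.2) /\
    end_homogeneous k col v'
  else True.

Lemma pigeonhole_filter (T : Type) (C : finType) (f : T -> C) (m : nat)
    (v : seq T) :
  #|C| * m < size v -> exists c, m < size [seq p <- v | f p == c].
Proof.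
move=> h; apply/existsP; apply: contraTT h; rewrite negb_exists => /forallP h.
rewrite -leqNgt -sum1_size (partition_big f predT) //=.
rewrite -sum_nat_const; apply: leq_sum => c _.
rewrite -big_filter sum1_size leqNgt; exact: h.
Qed.

Lemma end_homogeneous_filter (T C : eqType) k (col : seq T -> C) a v :
  end_homogeneous k col v -> end_homogeneous k col (filter a v).
Proof.
elim: v => //= p v IH [h1 h2].
case: (a p) => /=; last exact: IH.
split=> [u su|]; last exact: IH.
by apply: h1; apply: subseq_trans su _; apply: map_subseq; exact: filter_subseq.
Qed.

(** Induction on [k]: applying the case [k] to [fun u => col (x :: u)], one head [x] at a time,
    yields an end-homogeneous sequence, and pigeonhole on the recorded colours makes it homogeneous.
    [L] is uniform in [T], [s] and [col], hence later in the poset. *)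
Lemma ramsey (k : nat) (C : finType) (m : nat) :
  exists L, forall (T : eqType) (s : seq T) (col : seq T -> C), L <= size s ->
    exists s', [/\ subseq s' s, size s' = m &
      exists c, forall u, subseq u s' -> size u = k -> col u = c].
Proof.
elim: k m => [|k IHk] m.
  exists m => T s col hs; exists (take m s).
  split; [exact: take_subseq | exact: size_takel |].
  by exists (col [::]) => u _ /size0nil ->.
have eh M : exists L, forall (T : eqType) (s : seq T) (col : seq T -> C),
    L <= size s -> exists v, [/\ subseq (unzip1 v) s, size v = M &
      end_homogeneous k col v].
  elim: M => [|M [L IHM]].
    by exists 0 => T s col _; exists [::]; split=> //; rewrite sub0seq.
  have [L' hL'] := IHk L.
  exists L'.+1 => T [//|x s] col /= hs.
  have [s1 [sub1 sz1 [c hc]]] := hL' T s (fun u => col (x :: u)) hs.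
  have [|v [sub2 sz2 ehv]] := IHM T s1 col; first by rewrite sz1.
  exists ((x, c) :: v); split; rewrite /= ?sz2 ?eqxx //.
    exact: subseq_trans sub1.
  by split=> // u su; apply: hc; exact: subseq_trans su sub2.
have [L hL] := eh (#|C| * m).+1.
exists L => T s col hs.
have [v [sub sz ehv]] := hL T s col hs.
have [c hc] : exists c, m < size [seq p <- v | p.2 == c].
  by apply: pigeonhole_filter; rewrite sz.
have {ehv} := end_homogeneous_filter (fun p => p.2 == c) ehv.
have {sub} : subseq (unzip1 [seq p <- v | p.2 == c]) s.
  by apply: subseq_trans sub; apply: map_subseq; exact: filter_subseq.
have := filter_all (fun p : T * C => p.2 == c) v.
move: (filter _ v) hc => {sz}v hc all_c sub ehv.
exists (take m (unzip1 v)); split.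
- exact: subseq_trans (take_subseq _ _) sub.
- by rewrite size_takel // size_map ltnW.
exists c => u su szu.
have {}su : subseq u (unzip1 v) by exact: subseq_trans su (take_subseq _ _).
elim: v all_c ehv su {sub hc} => [_ _|[x c'] v IH /= /andP [/eqP ->]].
  by rewrite subseq0 => /eqP uE; rewrite uE in szu.
move=> all_c [h1 h2]; case: u szu IH => // y u [szu] IH.
case: eqP => [-> su|_ su]; first exact: h1.
exact: IH.
Qed.

End Ramsey.

(** * Uniform probability on a finite set *)

Section Expect.
Variables (R : realFieldType) (W : finType) (Om : {set W}).

Definition expect (F : W -> R) : R := (\sum_(w in Om) F w) / #|Om|%:R.
Definition prob (E : pred W) : R := expect (fun w => (E w)%:R).

Lemma expectD F G : expect (fun w => F w + G w) = expect F + expect G.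
Proof. by rewrite /expect big_split mulrDl. Qed.

Lemma expectN F : expect (fun w => - F w) = - expect F.
Proof. by rewrite /expect sumrN mulNr. Qed.

Lemma expectB F G : expect (fun w => F w - G w) = expect F - expect G.
Proof. by rewrite expectD expectN. Qed.

Lemma expectZ a F : expect (fun w => a * F w) = a * expect F.
Proof. by rewrite /expect -mulr_sumr mulrA. Qed.

Lemma expect_sum (I : Type) (r : seq I) (Q : pred I) (F : I -> W -> R) :
  expect (fun w => \sum_(i <- r | Q i) F i w) = \sum_(i <- r | Q i) expect (F i).
Proof. by rewrite /expect exchange_big mulr_suml. Qed.

Lemma eq_expect F G : {in Om, F =1 G} -> expect F = expect G.
Proof. by move=> h; congr (_ / _); apply: eq_bigr => w /h. Qed.

Lemma ler_expect F G : (forall w, w \in Om -> F w <= G w) -> expect F <= expect G.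
Proof. by move=> h; rewrite ler_wpM2r ?invr_ge0 // ler_sum. Qed.

Lemma expect_ge0 F : (forall w, w \in Om -> 0 <= F w) -> 0 <= expect F.
Proof. by move=> h; rewrite mulr_ge0 ?invr_ge0 // sumr_ge0. Qed.

Lemma expect_cst a : Om != set0 -> expect (fun=> a) = a.
Proof.
rewrite -card_gt0 => h; rewrite /expect sumr_const -(mulr_natr a) mulfK //.
by rewrite pnatr_eq0 -lt0n.
Qed.

Lemma probE E : prob E = #|[set w in Om | E w]|%:R / #|Om|%:R.
Proof.
congr (_ / _); rewrite -natr_sum -sum1_card; congr _%:R.
rewrite [LHS](big_setID [set w | E w]) /= [X in (_ + X)%N]big1 ?addn0.
  by apply: eq_big => [w|w]; rewrite !inE // => /andP [_ ->].
by move=> w; rewrite !inE => /andP [/negbTE ->].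
Qed.

Lemma prob_ge0 E : 0 <= prob E.
Proof. by apply: expect_ge0 => w _; rewrite ler0n. Qed.

Lemma ler_prob (E E' : pred W) :
  (forall w, w \in Om -> E w -> E' w) -> prob E <= prob E'.
Proof.
move=> h; apply: ler_expect => w wO; rewrite ler_nat.
by case Ew : (E w) => //; rewrite (h w wO Ew).
Qed.

Lemma prob_le1 E : prob E <= 1.
Proof.
have [O0|h] := eqVneq Om set0.
  by rewrite probE O0 cards0 invr0 mulr0.
by rewrite -[leRHS](expect_cst _ h); apply: ler_expect => w _; rewrite lern1; case: (E w).
Qed.

Lemma prob_or (E E' : pred W) :
  prob (fun w => E w || E' w) <= prob E + prob E'.
Proof.
rewrite -expectD; apply: ler_expect => w _; rewrite -natrD ler_nat.
by case: (E w); case: (E' w).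
Qed.

Lemma prob_not E : Om != set0 -> prob (fun w => ~~ E w) = 1 - prob E.
Proof.
move=> h; rewrite -[X in X - _](expect_cst _ h) -expectB; apply: eq_expect => w _.
by case: (E w); rewrite /= ?subr0 ?subrr.
Qed.

(** Averaging [2 * eta * |F| <= F^2 + eta^2] replaces Cauchy-Schwarz and avoids square roots. *)
Lemma expect_norm_le F eta : Om != set0 -> 0 < eta ->
  expect (fun w => F w ^+ 2) <= eta ^+ 2 -> expect (fun w => `|F w|) <= eta.
Proof.
move=> h0 h.
have : expect (fun w => (2 * eta) * `|F w|) <= expect (fun w => F w ^+ 2 + eta ^+ 2).
  apply: ler_expect => w _; rewrite -subr_ge0 -(real_normK (num_real (F w))).
  have -> : `|F w| ^+ 2 + eta ^+ 2 - 2 * eta * `|F w| = (`|F w| - eta) ^+ 2 by ring.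
  exact: sqr_ge0.
rewrite expectZ expectD expect_cst //; move: (expect _) (expect _) => x y h1 h2.
by rewrite -(ler_pM2l (x := 2 * eta)) ?mulr_gt0 //; lra.
Qed.

End Expect.

(** * Approximately exchangeable subsequences *)

Lemma sumr_cst_seq (R : realFieldType) (I : Type) (r : seq I) (x : R) :
  \sum_(i <- r) x = (size r)%:R * x.
Proof. by rewrite big_const_seq count_predT iter_addr_0 mulr_natl. Qed.

Section Law.
Variables (R : realFieldType) (W : finType) (Om : {set W}).
Variables (B : nat) (T : eqType) (X : T -> W -> 'I_B).

Definition law (u : seq T) (c : seq 'I_B) : R :=
  prob R Om (fun w => [seq X v w | v <- u] == c).

(** The empirical frequency of bin [a] in the block [D], a finite counterpart of the directing
    random measure in de Finetti's theorem. *)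
Definition block_mean (D : seq T) (a : 'I_B) (w : W) : R :=
  (\sum_(v <- D) (X v w == a)%:R) / (size D)%:R.

Lemma block_mean_ge0 D a w : 0 <= block_mean D a w.
Proof. by rewrite mulr_ge0 ?invr_ge0 // sumr_ge0. Qed.

Lemma block_mean_le1 D a w : block_mean D a w <= 1.
Proof.
have [->|D0] := eqVneq D [::]; first by rewrite /block_mean invr0 mulr0.
rewrite ler_pdivrMr ?ltr0n ?lt0n ?size_eq0 // mul1r -natr_sum ler_nat.
by rewrite -sum1_size leq_sum // => v _; case: (_ == _).
Qed.

Fixpoint transversal (Ds : seq (seq T)) (u : seq T) : bool :=
  match Ds, u with
  | D :: Ds', v :: u' => (v \in D) && transversal Ds' u'
  | [::], [::] => true
  | _, _ => false
  end.

Lemma transversal_subseq Ds u : transversal Ds u -> subseq u (flatten Ds).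
Proof.
elim: Ds u => [|D Ds IH] [|v u] //= /andP [vD /IH].
by rewrite -[v :: u]cat1s; apply: cat_subseq; rewrite sub1seq.
Qed.

Lemma size_transversal Ds u : transversal Ds u -> size u = size Ds.
Proof. by elim: Ds u => [|D Ds IH] [|v u] //= /andP [_ /IH ->]. Qed.

Lemma transversal_exists (Ds : seq (seq T)) :
  [::] \notin Ds -> exists u, transversal Ds u.
Proof.
elim: Ds => [|D Ds IH]; first by exists [::].
rewrite inE negb_or => /andP [D0 /IH [u hu]].
case: D D0 => // v D _; exists (v :: u) => /=; by rewrite mem_head.
Qed.

Fixpoint transversal_mean (Ds : seq (seq T)) (F : seq T -> R) : R :=
  if Ds is D :: Ds' then
    (\sum_(v <- D) transversal_mean Ds' (fun u => F (v :: u))) / (size D)%:R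
  else F [::].

Lemma transversal_mean_close (Ds : seq (seq T)) (F : seq T -> R) r g :
  [::] \notin Ds -> (forall u, transversal Ds u -> `|F u - r| <= g) ->
  `|transversal_mean Ds F - r| <= g.
Proof.
elim: Ds F => [|D Ds IH] F /=; first by move=> _ h; apply: (h [::]).
rewrite inE negb_or => /andP [D0 nD] h.
have sD : 0 < (size D)%:R :> R.
  by rewrite ltr0n lt0n size_eq0 eq_sym.
rewrite -(ler_pM2l sD) -{1}(gtr0_norm sD) -normrM mulrBr mulrCA divff ?gt_eqF // mulr1.
rewrite -sumr_cst_seq.
rewrite -sumrB; apply: (le_trans (ler_norm_sum _ _ _)).
apply: (@le_trans _ _ (\sum_(v <- D) g)).
  rewrite !big_seq; apply: ler_sum => v vD; apply: IH => // u hu.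
  by apply: h; rewrite /= vD.
by rewrite sumr_cst_seq.
Qed.

Lemma eq_transversal_mean (Ds : seq (seq T)) (F G : seq T -> R) :
  F =1 G -> transversal_mean Ds F = transversal_mean Ds G.
Proof.
elim: Ds F G => [|D Ds IH] F G h /=; first exact: h.
by congr (_ / _); apply: eq_bigr => v _; apply: IH => u; exact: h.
Qed.

(** Averaging over each block separately turns the indicator of a joint value into a product of
    block frequencies. The weight [psi] carries the indicators of the choices already made through
    the induction. *)
Lemma transversal_mean_law (Ds : seq (seq T)) (psi : W -> R) (c : seq 'I_B) :
  size c = size Ds ->
  transversal_mean Ds (fun u => expect Om (fun w =>
      psi w * ([seq X v w | v <- u] == c)%:R)) =
  expect Om (fun w => psi w * \prod_(p <- zip Ds c) block_mean p.1 p.2 w).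
Proof.
elim: Ds psi c => [|D Ds IH] psi [|a c] //=.
  by move=> _; apply: eq_expect => w _; rewrite big_nil.
move=> [sz].
transitivity ((\sum_(v <- D) expect Om (fun w => (psi w * (X v w == a)%:R) *
     \prod_(p <- zip Ds c) block_mean p.1 p.2 w)) / (size D)%:R).
  congr (_ / _); apply: eq_bigr => v _; rewrite -IH //.
  apply: eq_transversal_mean => u; apply: eq_expect => w _.
  by rewrite /= eqseq_cons -mulrA -natrM mulnb.
rewrite -expect_sum mulrC -expectZ; apply: eq_expect => w _.
rewrite big_cons /= -mulr_suml -mulr_sumr /block_mean; ring.
Qed.

(** Telescoping, with all factors in [0, 1]. *)
Lemma prod_diff_le (Ds : seq (seq T)) (D0 : seq T) (c : seq 'I_B) w :
  `|\prod_(p <- zip Ds c) block_mean p.1 p.2 w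
     - \prod_(p <- zip Ds c) block_mean D0 p.2 w| <=
  \sum_(p <- zip Ds c) `|block_mean p.1 p.2 w - block_mean D0 p.2 w|.
Proof.
move: (zip Ds c) => l {Ds c}.
elim: l => [|p l IH]; first by rewrite !big_nil subrr normr0.
have l01 : 0 <= \prod_(p <- l) block_mean D0 p.2 w <= 1.
  elim/big_ind: _ => [|x y /andP [x0 x1] /andP [y0 y1]|q _].
  - by rewrite ler01 lexx.
  - by rewrite mulr_ge0 // mulr_ile1.
  - by rewrite block_mean_ge0 block_mean_le1.
rewrite !big_cons.
move: (\prod_(p <- l) block_mean p.1 p.2 w) IH => P1.
move: (\prod_(p <- l) block_mean D0 p.2 w) l01 => P2.
have := block_mean_ge0 p.1 p.2 w; have := block_mean_le1 p.1 p.2 w.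
move: (block_mean p.1 p.2 w) (block_mean D0 p.2 w) => x y x1 x0 /andP [p0 p1] IH.
have -> : x * P1 - y * P2 = (x - y) * P2 + x * (P1 - P2) by ring.
apply: (le_trans (ler_normD _ _)); rewrite !normrM (ger0_norm p0) (ger0_norm x0).
apply: lerD; first by rewrite ler_piMr.
by apply: le_trans IH; rewrite ler_piMl.
Qed.

Lemma expect_block_meanM (D D' : seq T) a :
  expect Om (fun w => block_mean D a w * block_mean D' a w) =
  (\sum_(u <- D) \sum_(v <- D') law [:: u; v] [:: a; a])
    / ((size D)%:R * (size D')%:R).
Proof.
transitivity (expect Om (fun w => ((size D)%:R * (size D')%:R)^-1 *
  \sum_(u <- D) \sum_(v <- D') (([seq X x w | x <- [:: u; v]] == [:: a; a])%:R : R))).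
  apply: eq_expect => w _; rewrite /block_mean invfM.
  transitivity ((size D)%:R^-1 / (size D')%:R * ((\sum_(u <- D) (X u w == a)%:R) *
     (\sum_(v <- D') (X v w == a)%:R)) : R); first by ring.
  congr (_ * _); rewrite big_distrl /=; apply: eq_bigr => u _.
  rewrite big_distrr /=; apply: eq_bigr => v _.
  by rewrite !eqseq_cons eqxx andbT -natrM mulnb.
rewrite expectZ mulrC expect_sum; congr (_ / _); apply: eq_bigr => u _.
by rewrite expect_sum.
Qed.

(** Expanding the square leaves only laws of pairs. For distinct elements these equal [r] up to [g],
    so [r] cancels between the squares and the cross term; the [m] diagonal pairs out of [m * m] add
    at most [1/m] to each square. *)
Lemma block_mean_L2 (D D' : seq T) (a : 'I_B) m r g :
  (0 < m)%N -> size D = m -> size D' = m -> uniq D -> uniq D' ->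
  (forall u v, u \in D -> v \in D' -> u != v) ->
  (forall u v, u \in D ++ D' -> v \in D ++ D' -> u != v ->
     `|law [:: u; v] [:: a; a] - r| <= g) ->
  expect Om (fun w => (block_mean D a w - block_mean D' a w) ^+ 2) <=
    2 / m%:R + 4 * g.
Proof.
move=> m0 sD sD' uD uD' dis hom.
have m0R : 0 < m%:R :> R by rewrite ltr0n.
(* [r] approximates a probability, so [r + g] may be added on the diagonal as well. *)
have rg : 0 <= r + g.
  case: D sD uD dis hom => [e|u D sD uD dis hom]; first by rewrite -e in m0.
  case: D' sD' uD' dis hom => [e|v D' sD' uD' dis hom]; first by rewrite -e in m0.
  have : `|law [:: u; v] [:: a; a] - r| <= g.
    by apply: hom; rewrite ?inE ?mem_cat ?inE ?eqxx ?orbT // dis // mem_head.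
  have := prob_ge0 R Om (fun w => [seq X x w | x <- [:: u; v]] == [:: a; a]).
  rewrite -/(law _ _) ler_norml => h /andP [_]; lra.
have diag E : size E = m -> uniq E -> {subset E <= D ++ D'} ->
    expect Om (fun w => block_mean E a w * block_mean E a w) <= m%:R^-1 + (r + g).
  move=> sE uE sub; rewrite expect_block_meanM sE ler_pdivrMr ?mulr_gt0 //.
  apply: (@le_trans _ _ (\sum_(u <- E) \sum_(v <- E) ((v == u)%:R + (r + g)))).
    rewrite !big_seq; apply: ler_sum => u uE'; rewrite !big_seq.
    apply: ler_sum => v vE; have [vu|vu] := eqVneq v u.
      by apply: ler_wpDr => //; exact: prob_le1.
    have := hom u v (sub _ uE') (sub _ vE); rewrite eq_sym vu => /(_ isT).
    by rewrite ler_norml => /andP [_]; rewrite add0r; lra.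
  under eq_bigr => u _ do rewrite big_split /= sumr_cst_seq.
  rewrite big_split /= sumr_cst_seq sE.
  rewrite [X in X + _](_ : _ = m%:R).
    rewrite le_eqVlt; apply/orP; left; apply/eqP; field.
    by rewrite gt_eqF.
  rewrite big_seq (eq_bigr (fun=> 1)) => [|u uE']; last first.
    rewrite -natr_sum (_ : (\sum_(v <- E) (v == u))%N = count_mem u E).
      by rewrite count_uniq_mem // uE'.
    by rewrite -sum1_count [RHS]big_mkcond; apply: eq_bigr => v _ /=; case: eqP.
  by rewrite -big_seq sumr_cst_seq sE mulr1.
have cross : r - g <= expect Om (fun w => block_mean D a w * block_mean D' a w).
  rewrite expect_block_meanM sD sD' ler_pdivlMr ?mulr_gt0 //.
  apply: (@le_trans _ _ (\sum_(u <- D) \sum_(v <- D') (r - g))).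
    by under eq_bigr => u _ do rewrite sumr_cst_seq; rewrite sumr_cst_seq sD sD' [leRHS]mulrA [leLHS]mulrC.
  rewrite !big_seq; apply: ler_sum => u uD0; rewrite !big_seq.
  apply: ler_sum => v vD0.
  have := hom u v; rewrite !mem_cat uD0 vD0 orbT => /(_ isT isT (dis _ _ uD0 vD0)).
  by rewrite ler_norml => /andP [+ _]; lra.
have h1 : expect Om (fun w => block_mean D a w * block_mean D a w) <= m%:R^-1 + (r + g).
  by apply: diag => // x xD; rewrite mem_cat xD.
have h2 : expect Om (fun w => block_mean D' a w * block_mean D' a w) <= m%:R^-1 + (r + g).
  by apply: diag => // x xD; rewrite mem_cat xD orbT.
rewrite (eq_expect (G := fun w => block_mean D a w * block_mean D a w +
   (block_mean D' a w * block_mean D' a w +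
    - 2 * (block_mean D a w * block_mean D' a w)))); last first.
  by move=> w _; ring.
rewrite !expectD expectZ.
lra.
Qed.
End Law.

Section ApproxExchangeable.
Variable R : archiRealFieldType.

Lemma ex_inv_le (e : R) : 0 < e -> exists2 n : nat, (0 < n)%N & n%:R^-1 <= e.
Proof.
move=> e0; have /archi_boundP h : 0 <= e^-1 by rewrite invr_ge0 ltW.
exists (Num.bound e^-1).+1 => //.
rewrite -[leRHS]invrK lef_pV2 ?posrE ?invr_gt0 ?ltr0n //.
by rewrite (le_trans (ltW h)) // ler_nat.
Qed.

(** A [j]-subsequence is coloured by its law on [j]-tuples of bins, rounded down to multiples of
    [1/G]; this uses finitely many colours. *)
Lemma ramsey_law (B j m : nat) (g : R) : 0 < g ->
  exists L, forall (W : finType) (Om : {set W}) (T : eqType) (s : seq T)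
      (X : T -> W -> 'I_B), Om != set0 -> (L <= size s)%N ->
    exists s', [/\ subseq s' s, size s' = m & forall c : seq 'I_B, size c = j ->
      exists r, forall u, subseq u s' -> size u = j -> `|law R Om X u c - r| <= g].
Proof.
move=> /ex_inv_le [G G0 hG].
have [L hL] := ramsey j {ffun j.-tuple 'I_B -> 'I_G.+1} m.
exists L => W Om T s X Om0 hs.
pose col (u : seq T) := [ffun c : j.-tuple 'I_B =>
  inord ((#|[set w in Om | [seq X v w | v <- u] == c]| * G) %/ #|Om|) : 'I_G.+1].
have [s' [sub sz [f hf]]] := hL T s col hs; exists s'; split=> // c szc.
have szc' : size c == j by apply/eqP.
exists ((f (Tuple szc'))%:R / G%:R) => u su szu.
rewrite -(hf u su szu) ffunE /law probE /=.
set n := #|[set _ in _ | _]|.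
have cO : (0 < #|Om|)%N by rewrite card_gt0.
have nO : (n <= #|Om|)%N by apply: subset_leq_card; apply/subsetP => w; rewrite inE => /andP [].
rewrite inordK; last first.
  by rewrite ltnS -(leq_pmul2r cO) (leq_trans (leq_trunc_div _ _)) // mulnC leq_mul.
apply: le_trans hG.
have E := divn_eq (n * G) #|Om|; have lt := ltn_pmod (n * G) cO.
move: (_ %/ _)%N (_ %% _)%N E lt => q e E lt.
have GR : 0 < G%:R :> R by rewrite ltr0n.
have OR : 0 < #|Om|%:R :> R by rewrite ltr0n.
have -> : n%:R / #|Om|%:R - q%:R / G%:R = e%:R / (#|Om|%:R * G%:R) :> R.
  have -> : e%:R = n%:R * G%:R - q%:R * #|Om|%:R :> R.
    by rewrite -!natrM E natrD; lra.
  by field; rewrite !gt_eqF.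
rewrite ger0_norm ?divr_ge0 ?mulr_ge0 // ler_pdivrMr ?mulr_gt0 //.
by rewrite mulrC -mulrA divff ?gt_eqF // mulr1 ler_nat ltnW.
Qed.

Lemma subseq_pair (T : eqType) (s : seq T) u v : u \in s -> v \in s -> u != v ->
  subseq [:: u; v] s || subseq [:: v; u] s.
Proof.
elim: s => // x s IH; rewrite !inE => /orP [/eqP ->|us] /orP [/eqP ->|vs] nuv.
- by rewrite eqxx in nuv.
- by rewrite /= eqxx sub1seq vs.
- by rewrite /= eqxx sub1seq us orbT.
have /orP [h|h] := IH us vs nuv; apply/orP; [left|right];
  exact: subseq_trans h (subseq_cons _ _).
Qed.

Lemma law_pairC (W : finType) (Om : {set W}) B (T : eqType) (X : T -> W -> 'I_B) u v a :
  law R Om X [:: u; v] [:: a; a] = law R Om X [:: v; u] [:: a; a].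
Proof.
apply: eq_expect => w _; rewrite /= !eqseq_cons eqxx !andbT; by rewrite andbC.
Qed.

(** Cut a homogeneous sequence into [k] blocks. The law of one transversal [Y] is close to the mean
    over all transversals, an expected product of block frequencies. These frequencies are close in
    mean, so every block may be replaced by the first one, and the product no longer depends on the
    order of [c]. *)
Lemma approx_exchangeable (B k : nat) (eta : R) : 0 < eta ->
  exists L, forall (W : finType) (Om : {set W}) (T : eqType) (s : seq T)
      (X : T -> W -> 'I_B), Om != set0 -> uniq s -> (L <= size s)%N ->
    exists (Y : seq T) (S : seq 'I_B -> R), [/\ subseq Y s, size Y = k,
      forall c, size c = k -> `|law R Om X Y c - S c| <= eta &
      forall c c', perm_eq c c' -> S c = S c'].
Proof.
(* The constants give [2/m + 4 * g <= e^2] for the comparison of blocks and [2 * g + k * e <= eta]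
   for the total error. *)
move=> eta0; pose e : R := eta / (2 * k.+1%:R).
have e0 : 0 < e by rewrite divr_gt0 ?mulr_gt0 ?ltr0n.
pose g := Num.min (eta / 4) (e ^+ 2 / 8).
have g0 : 0 < g by rewrite lt_min !divr_gt0 ?exprn_gt0.
have [m m0 hm] : exists2 m : nat, (0 < m)%N & m%:R^-1 <= e ^+ 2 / 4.
  by apply: ex_inv_le; rewrite divr_gt0 ?exprn_gt0.
(* Homogeneity for pairs is secured first, on a sequence long enough to contain one that is also
   homogeneous for [k]-subsequences. *)
have [L1 hL1] := ramsey_law B k (k * m) g0.
have [L2 hL2] := ramsey_law B 2 L1 g0.
exists L2 => W Om T s0 X Om0 us0 hs0.
have [s1 [sub1 sz1 hom2]] := hL2 W Om T s0 X Om0 hs0.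
have [|s [sub sz homk]] := hL1 W Om T s1 X Om0; first by rewrite sz1.
have us : uniq s by apply: subseq_uniq us0; exact: subseq_trans sub sub1.
pose Ds := reshape (nseq k m) s.
have sumE : sumn (nseq k m) = size s by rewrite sumn_nseq sz mulnC.
have flatE : flatten Ds = s by rewrite reshapeKr // sumE.
have shapeE : shape Ds = nseq k m by rewrite reshapeKl // sumE.
have szDs : size Ds = k by rewrite -(size_map size) -/(shape _) shapeE size_nseq.
have szD D : D \in Ds -> size D = m.
  move=> /(map_f size); rewrite -/(shape _) shapeE.
  by rewrite mem_nseq => /andP [_ /eqP].
have nnil : [::] \notin Ds by apply/negP => /szD /= e1; rewrite -e1 in m0.
have [Y tY] := transversal_exists nnil.
pose D0 := head [::] Ds.
exists Y, (fun c => expect Om (fun w => \prod_(a <- c) block_mean R X D0 a w)).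
have subtv u : transversal Ds u -> subseq u s.
  by move=> /transversal_subseq; rewrite flatE.
have sztv u : transversal Ds u -> size u = k.
  by move=> /size_transversal; rewrite szDs.
split; first by apply: subseq_trans (subtv _ tY) _; exact: subseq_trans sub sub1.
- exact: sztv.
- move=> c szc; have [r hr] := homk c szc.
  have hY := hr Y (subtv _ tY) (sztv _ tY).
  have hmean : `|transversal_mean Ds (fun u => law R Om X u c) - r| <= g.
    by apply: transversal_mean_close => // u tu; apply: hr; [exact: subtv|exact: sztv].
  rewrite (eq_transversal_mean _ (G := fun u => expect Om (fun w =>
      1 * ([seq X v w | v <- u] == c)%:R))) in hmean; last first.
    by move=> u; apply: eq_expect => w _; rewrite mul1r.
  rewrite transversal_mean_law ?szDs // in hmean.
  have L1D D a : D \in Ds ->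
      expect Om (fun w => `|block_mean R X D a w - block_mean R X D0 a w|) <= e.
    move=> DDs; have [->|nD] := eqVneq D D0.
      rewrite (eq_expect (G := fun=> 0)) ?expect_cst ?ltW // => w _.
      by rewrite subrr normr0.
    have [Ds' DsE] : exists Ds', Ds = D0 :: Ds'.
      by rewrite /D0; case: (Ds) DDs => // D1 Ds' _; exists Ds'.
    have D0Ds : D0 \in Ds by rewrite DsE mem_head.
    have DDs' : D \in Ds' by move: DDs; rewrite DsE inE (negbTE nD).
    have uflat : uniq (flatten Ds) by rewrite flatE.
    have uD E : E \in Ds -> uniq E.
      move=> EDs; move: uflat; case/splitPr: EDs => l1 l2.
      by rewrite flatten_cat /= !cat_uniq => /and3P [_ _ /and3P []].
    apply: expect_norm_le => //.
    have [r2 hr2] := hom2 [:: a; a] erefl.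
    apply: (@le_trans _ _ (2 / m%:R + 4 * g)).
      apply: (@block_mean_L2 _ _ _ _ _ _ _ _ _ _ r2); rewrite ?szD ?uD //.
        move=> u v uD1 vD0; move: uflat; rewrite DsE /= cat_uniq => /and3P [_ /hasPn h _].
        apply: contraTneq vD0 => <-; apply: h; apply/flattenP; by exists D.
      move=> u v hu hv nuv.
      have DDs_s x : x \in D ++ D0 -> x \in s1.
        move=> hx; apply: (mem_subseq sub); rewrite -flatE; apply/flattenP.
        by move: hx; rewrite mem_cat => /orP [] ?; [exists D|exists D0].
      (* The value [[:: a; a]] is symmetric, so the order of [u] and [v] in [s1] is immaterial. *)
      have /orP [h|h] := subseq_pair (DDs_s _ hu) (DDs_s _ hv) nuv.
        exact: hr2.
      by rewrite law_pairC; exact: hr2.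
    have : g <= e ^+ 2 / 8 by rewrite ge_min lexx orbT.
    by move: hm; move: (e ^+ 2) => x; lra.
  have diff : `|expect Om (fun w => 1 * \prod_(p <- zip Ds c) block_mean R X p.1 p.2 w) -
      expect Om (fun w => \prod_(a <- c) block_mean R X D0 a w)| <= k%:R * e.
    have zc w : \prod_(a <- c) block_mean R X D0 a w =
        \prod_(p <- zip Ds c) block_mean R X D0 p.2 w.
      rewrite -(big_map snd predT (fun a => block_mean R X D0 a w)).
      by rewrite -/(unzip2 _) unzip2_zip // szDs szc.
    rewrite -expectB.
    apply: (@le_trans _ _ (expect Om (fun w => \sum_(p <- zip Ds c)
        `|block_mean R X p.1 p.2 w - block_mean R X D0 p.2 w|))).
      rewrite ler_norml -expectN; apply/andP; split; apply: ler_expect => w _;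
        have := prod_diff_le R X Ds D0 c w;
        by rewrite ler_norml mul1r zc => /andP [].
    rewrite expect_sum; apply: (@le_trans _ _ (\sum_(p <- zip Ds c) e)).
      rewrite !big_seq; apply: ler_sum => p pz; apply: L1D.
      move/(map_f fst): pz; rewrite -/unzip1 unzip1_zip ?szDs ?szc //.
    by rewrite sumr_cst_seq size_zip szDs szc minnn.
  have ke : k%:R * e <= eta / 2.
    have <- : k.+1%:R * e = eta / 2.
      rewrite /e; have : k.+1%:R != 0 :> R by rewrite pnatr_eq0.
      by move: k.+1%:R => x x0; field.
    by rewrite ler_wpM2r ?ler_nat // ltW.
  have g4 : g <= eta / 4 by rewrite ge_min lexx.
  move: hY hmean diff; rewrite !ler_norml => /andP [a1 a2] /andP [a3 a4] /andP [a5 a6].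
  apply/andP; lra.
- move=> c c' pc; apply: eq_expect => w _; exact: perm_big.
Qed.

End ApproxExchangeable.

Lemma sorted_permutation_exists (T : eqType) (Y : seq T) (f : T -> nat) :
  uniq [seq f v | v <- Y] ->
  exists2 t, t \in permutations Y & sorted ltn [seq f v | v <- t].
Proof.
move=> uY; exists (sort (relpre f leq) Y).
  by rewrite mem_permutations perm_sort.
rewrite ltn_sorted_uniq_leq sorted_map; apply/andP; split.
  by rewrite (perm_uniq (perm_map f (permEl (perm_sort _ _)))).
by apply: sort_sorted => x y; exact: leq_total.
Qed.

Lemma not_uniq_map_le (T : eqType) (Y : seq T) (f : T -> nat) : uniq Y ->
  (~~ uniq [seq f v | v <- Y] <=
    \sum_(u <- Y) \sum_(v <- Y) ((u != v) && (f u == f v)))%N.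
Proof.
move=> uY; set S := leqRHS; case: (posnP S) => [|h]; last first.
  by apply: leq_trans h; case: (uniq _).
move=> /eqP; rewrite /S sum_nat_seq_eq0 => /allP h.
rewrite map_inj_in_uniq ?uY // => u v uY' vY' fE.
apply/eqP; have := h u uY'; rewrite sum_nat_seq_eq0 => /allP /(_ v vY').
by rewrite fE eqxx andbT eqb0 negbK.
Qed.

(** * From symmetric laws to nearly uniform orderings *)

Section Orderings.
Variable R : archiRealFieldType.

Lemma prob_sorted_law (W : finType) (Om : {set W}) B k (T : eqType)
    (X : T -> W -> 'I_B) (t : seq T) : size t = k ->
  prob R Om (fun w => sorted ltn [seq nat_of_ord (X v w) | v <- t]) =
  \sum_(c : k.-tuple 'I_B | sorted ltn [seq nat_of_ord a | a <- c]) law R Om X t c.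
Proof.
move=> szt; rewrite /prob -expect_sum; apply: eq_expect => w _.
have sz : size [seq X v w | v <- t] == k by rewrite size_map szt.
have E : [seq nat_of_ord (X v w) | v <- t] =
    [seq nat_of_ord a | a <- [seq X v w | v <- t]] by rewrite -map_comp.
rewrite -natr_sum; congr _%:R.
have [srt|nsrt] := boolP (sorted ltn [seq nat_of_ord (X v w) | v <- t]).
  rewrite (bigD1 (Tuple sz)) /= -?E ?srt // eqxx big1 ?addn0 // => c /andP [_ nc].
  by apply/eqP; rewrite eqb0; apply: contra nc => /eqP h; apply/eqP/val_inj.
rewrite big1 // => c; case: eqP => // <-; by rewrite -E (negbTE nsrt).
Qed.

Lemma law_perm_eq (W : finType) (Om : {set W}) B (T : eqType) (X : T -> W -> 'I_B)
    (t Y : seq T) (c : seq 'I_B) : uniq Y -> perm_eq t Y -> size c = size t ->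
  exists2 c', perm_eq c' c & law R Om X t c = law R Om X Y c'.
Proof.
move=> uY pt sz; have ut : uniq t by rewrite (perm_uniq pt).
case: t => [|x0 t'] in pt sz ut *.
  have -> : Y = [::] by apply/perm_nilP; rewrite perm_sym.
  by exists c.
set t := x0 :: t' in pt sz ut *.
case: c sz => [//|a0 c'] sz; set c := a0 :: c' in sz *.
pose f v := nth a0 c (index v t).
have cE : c = [seq f v | v <- t].
  apply: (@eq_from_nth _ a0); rewrite ?size_map // => i ic.
  by rewrite (nth_map x0) -?sz // /f index_uniq // -sz.
exists [seq f v | v <- Y]; first by rewrite [in X in perm_eq _ X]cE perm_map // perm_sym.
apply: eq_expect => w _; congr (nat_of_bool _)%:R; rewrite {1}cE.
apply/eqP/eqP => /eq_in_map h; apply/eq_in_map => v hv; apply: h.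
  by rewrite (perm_mem pt).
by rewrite -(perm_mem pt).
Qed.

(** By the symmetry of [S], all orderings of [Y] have increasing bins with nearly the same
    probability [sigma]; whenever the bins are distinct some ordering is increasing, so [k! * sigma]
    is at least about 1. The collision bound [e] is fixed before the number [B] of bins, which may
    therefore depend on it. *)
Lemma nearly_uniform_orderings (k : nat) (eps : R) : 0 < eps ->
  exists2 e : R, 0 < e & forall B, exists L,
    forall (W : finType) (Om : {set W}) (T : eqType) (s : seq T)
      (X : T -> W -> 'I_B), Om != set0 -> uniq s -> (L <= size s)%N ->
    (forall u v, u \in s -> v \in s -> u != v ->
       prob R Om (fun w => X u w == X v w) <= e) ->
    exists Y : seq T, [/\ subseq Y s, size Y = k & forall t, perm_eq t Y ->
      k`!%:R^-1 - eps <=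
        prob R Om (fun w => sorted ltn [seq nat_of_ord (X v w) | v <- t])].
Proof.
move=> eps0; exists (eps / (2 * (k * k).+1%:R)).
  by rewrite divr_gt0 ?mulr_gt0 ?ltr0n.
set e := _ / _ => B.
(* Summing [eta] over the [M] tuples of bins costs at most [eps / 4], and the union bound over pairs
   of elements of [Y] at most [k * k * e <= eps / 2]. *)
pose M := #|{: k.-tuple 'I_B}|; pose eta := eps / (4 * M.+1%:R).
have eta0 : 0 < eta by rewrite divr_gt0 ?mulr_gt0 ?ltr0n.
have Meta : M%:R * eta <= eps / 4.
  apply: (@le_trans _ _ (M.+1%:R * eta)); first by rewrite ler_wpM2r ?ler_nat // ltW.
  rewrite /eta; have : M.+1%:R != 0 :> R by rewrite pnatr_eq0.
  by move: M.+1%:R => x x0; rewrite le_eqVlt; apply/orP; left; apply/eqP; field.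
have ke : (k * k)%:R * e <= eps / 2.
  apply: (@le_trans _ _ ((k * k).+1%:R * e)).
    by rewrite ler_wpM2r ?ler_nat // divr_ge0 ?mulr_ge0 // ltW.
  rewrite /e; have : (k * k).+1%:R != 0 :> R by rewrite pnatr_eq0.
  by move: (k * k).+1%:R => x x0; rewrite le_eqVlt; apply/orP; left; apply/eqP; field.
have [L hL] := approx_exchangeable B k eta0.
exists L => W Om T s X Om0 us hs col.
have [Y [S [sub szY hS Ssym]]] := hL W Om T s X Om0 us hs.
have uY : uniq Y by exact: subseq_uniq sub us.
exists Y; split=> // t0 pt0.
pose E (t : seq T) w := sorted ltn [seq nat_of_ord (X v w) | v <- t].
pose sigma := \sum_(c : k.-tuple 'I_B | sorted ltn [seq nat_of_ord a | a <- c]) S c.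
have near t : perm_eq t Y -> `|prob R Om (E t) - sigma| <= eps / 4.
  move=> pt; have szt : size t = k by rewrite (perm_size pt).
  rewrite /E (prob_sorted_law Om X szt) -sumrB.
  apply: (le_trans (ler_norm_sum _ _ _)).
  apply: (@le_trans _ _ (\sum_(c : k.-tuple 'I_B) eta)).
    rewrite [leLHS]big_mkcond; apply: ler_sum => c _; case: ifP => _; last exact: ltW.
    have [|c' pc ->] := @law_perm_eq _ Om _ _ X t Y c uY pt; first by rewrite size_tuple szt.
    by rewrite -(Ssym _ _ pc) hS // (perm_size pc) size_tuple.
  by rewrite sumr_const -(mulr_natl eta); exact: Meta.
have unif : 1 - (k * k)%:R * e <= \sum_(t <- permutations Y) prob R Om (E t).
  rewrite lerBlDr -lerBlDl -expect_sum.
  apply: (@le_trans _ _ (prob R Om (fun w => ~~ uniq [seq nat_of_ord (X v w) | v <- Y]))).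
    rewrite prob_not // lerD2l lerN2; apply: ler_expect => w _.
    case uX : (uniq _); last by rewrite sumr_ge0.
    have [t tY st] := sorted_permutation_exists uX.
    rewrite (big_rem t) //= /E st lerDl; exact: sumr_ge0.
  apply: (@le_trans _ _ (expect Om (fun w => \sum_(u <- Y) \sum_(v <- Y)
       ((u != v) && (X u w == X v w))%:R))).
    apply: ler_expect => w _; under eq_bigr => u _ do rewrite -natr_sum.
    by rewrite -natr_sum ler_nat; exact: (not_uniq_map_le _ uY).
  rewrite expect_sum; under eq_bigr => u _ do rewrite expect_sum.
  apply: (@le_trans _ _ (\sum_(u <- Y) \sum_(v <- Y) e)).
    rewrite !big_seq; apply: ler_sum => u uY'; rewrite !big_seq.
    apply: ler_sum => v vY.
    have [->|nuv] := eqVneq u v.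
      rewrite (eq_expect (G := fun=> 0)) // expect_cst //.
      by rewrite divr_ge0 ?mulr_ge0 // ltW.
    exact: col (mem_subseq sub uY') (mem_subseq sub vY) nuv.
  by under eq_bigr => u _ do rewrite sumr_cst_seq; rewrite sumr_cst_seq szY natrM mulrA.
have up : \sum_(t <- permutations Y) prob R Om (E t) <= k`!%:R * (sigma + eps / 4).
  rewrite -szY -(size_permutations uY) -sumr_cst_seq !big_seq.
  apply: ler_sum => t; rewrite mem_permutations => /near.
  by rewrite ler_norml => /andP [_]; lra.
have := near t0 pt0; rewrite ler_norml => /andP [+ _].
have kf : 1 <= k`!%:R :> R by rewrite ler1n fact_gt0.
have : (1 - eps / 2) / k`!%:R <= sigma + eps / 4.
  by rewrite ler_pdivrMr ?(lt_le_trans ltr01) // [leRHS]mulrC; lra.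
have : eps / 2 / k`!%:R <= eps / 2.
  by rewrite ler_pdivrMr ?(lt_le_trans ltr01) // ler_peMr //; lra.
rewrite /E; move: (prob _ _ _) => p; rewrite mulrBl mul1r; lra.
Qed.

End Orderings.

(** * The four functions theorem *)

Section FourFunctions.
Local Open Scope nat_scope.

(** The one-bit case. With [p = a1 * b0], [q = a0 * b1], [m = c1 * d0] and [r = c0 * d1], the
    hypotheses give [p, q <= m] and [p * q <= m * r]; for [m > 0], [(m - p) * (m - q) >= 0] then
    yields [p + q <= m + r]. *)
Lemma four_functions_step a0 a1 b0 b1 c0 c1 d0 d1 :
  a0 * b0 <= c0 * d0 -> a1 * b0 <= c1 * d0 ->
  a0 * b1 <= c1 * d0 -> a1 * b1 <= c1 * d1 ->
  (a0 + a1) * (b0 + b1) <= (c0 + c1) * (d0 + d1).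
Proof.
move=> h00 h10 h01 h11.
have hpq : (a1 * b0) * (a0 * b1) <= (c1 * d0) * (c0 * d1).
  have := leq_mul h00 h11; lia.
have key : a1 * b0 + a0 * b1 <= c1 * d0 + c0 * d1.
  move: (a1 * b0) (a0 * b1) (c1 * d0) (c0 * d1) h10 h01 hpq => p q m r hp hq hpq.
  case: m hp hq hpq => [|m] hp hq hpq; first by lia.
  rewrite -(leq_pmul2l (ltn0Sn m)); nia.
rewrite !mulnDl !mulnDr; lia.
Qed.

Fixpoint bitseqs (n : nat) : seq bitseq :=
  if n is n'.+1 then
    [seq false :: b | b <- bitseqs n'] ++ [seq true :: b | b <- bitseqs n']
  else [:: [::]].

Lemma mem_bitseqs n b : (b \in bitseqs n) = (size b == n).
Proof.
elim: n b => [|n IH] [|x b] //=.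
  by rewrite mem_cat; apply/negbTE; rewrite negb_or; apply/andP; split; apply/mapP => -[].
rewrite mem_cat eqSS -IH; case: x.
  rewrite (mem_map (f := cons true)); last by move=> ? ? [].
  by rewrite orbC; case: (b \in _) => //=; apply/mapP => -[].
rewrite (mem_map (f := cons false)); last by move=> ? ? [].
by case: (b \in _) => //=; apply/mapP => -[].
Qed.

Lemma uniq_bitseqs n : uniq (bitseqs n).
Proof.
elim: n => //= n IH; rewrite cat_uniq !map_inj_uniq ?IH //=; try by move=> ? ? [].
by rewrite andbT; apply/hasPn => _ /mapP [b _ ->]; apply/mapP => -[].
Qed.

Definition bitop (op : bool -> bool -> bool) (a b : bitseq) : bitseq :=
  [seq op p.1 p.2 | p <- zip a b].

(** Summing out the first bit preserves the hypothesis, by the one-bit case. *)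
Lemma four_functions n (alpha beta gamma delta : bitseq -> nat) :
  (forall a b, size a = n -> size b = n ->
     alpha a * beta b <= gamma (bitop orb a b) * delta (bitop andb a b)) ->
  (\sum_(a <- bitseqs n) alpha a) * (\sum_(a <- bitseqs n) beta a) <=
  (\sum_(a <- bitseqs n) gamma a) * (\sum_(a <- bitseqs n) delta a).
Proof.
elim: n alpha beta gamma delta => [|n IH] alpha beta gamma delta h /=.
  by rewrite !big_seq1; exact: (h [::] [::]).
rewrite !big_cat !big_map /= -!big_split /=; apply: IH => a b sa sb.
have hc x y : alpha (x :: a) * beta (y :: b) <=
    gamma ((x || y) :: bitop orb a b) * delta ((x && y) :: bitop andb a b).
  by apply: (h (x :: a) (y :: b)); rewrite /= ?sa ?sb.
apply: four_functions_step;
  [exact: (hc false false)|exact: (hc true false)|exact: (hc false true)|exact: (hc true true)].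
Qed.

Section Daykin.
Variables (I : finType) (L : nat).
Implicit Types (z : {ffun I -> 'I_L}) (A : {set {ffun I -> 'I_L}}).

Definition ffmax z z' := [ffun i => if z i <= z' i then z' i else z i].
Definition ffmin z z' := [ffun i => if z i <= z' i then z i else z' i].

(** Unary encoding by threshold indicators: it embeds the lattice of maps into a cube, turning
    [ffmax] and [ffmin] into bitwise [orb] and [andb]. *)
Definition code z : bitseq := [seq nat_of_ord p.2 < z p.1 | p : I * 'I_L <- enum {: I * 'I_L}].

Lemma code_inj : injective code.
Proof.
move=> z z' /eq_in_map h; apply/ffunP => i; apply/val_inj/eqP.
have {}h (j : 'I_L) : (j < z i) = (j < z' i).
  by apply: (h (i, j)); rewrite mem_enum.
by have := h (z i); have := h (z' i); rewrite !ltnn; case: ltngtP.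
Qed.

Lemma sum_code A :
  \sum_(l <- bitseqs (size (enum {: I * 'I_L}))) (l \in [seq code z | z <- enum A])
    = #|A|.
Proof.
set s := map _ _; set n := size _.
have us : uniq s by rewrite map_inj_uniq ?enum_uniq //; exact: code_inj.
rewrite cardE -(size_map code) -/s -sum1_size.
transitivity (\sum_(l <- bitseqs n | l \in s) 1).
  by rewrite [RHS]big_mkcond; apply: eq_bigr => l _; case: (l \in s).
rewrite -big_filter; apply: perm_big; apply: uniq_perm => //.
  by rewrite filter_uniq // uniq_bitseqs.
move=> l; rewrite mem_filter mem_bitseqs andb_idr // => /mapP [z _ ->].
by rewrite size_map.
Qed.

(** The four functions theorem for the indicators of the encoded sets. *)
Lemma daykin (A B C D : {set {ffun I -> 'I_L}}) :
  (forall a b, a \in A -> b \in B -> ffmax a b \in C /\ ffmin a b \in D) ->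
  #|A| * #|B| <= #|C| * #|D|.
Proof.
move=> h; rewrite -!sum_code; apply: four_functions => a b _ _.
case: (boolP (a \in _)) => // /mapP [z]; rewrite mem_enum => zA ->.
case: (boolP (b \in _)) => // /mapP [z']; rewrite mem_enum => zB ->.
have [hC hD] := h _ _ zA zB.
have opE op (z'' : {ffun I -> 'I_L}) :
    (forall i (j : 'I_L), op (j < z i) (j < z' i) = (j < z'' i)) ->
    bitop op (code z) (code z') = code z''.
  by move=> hop; rewrite /bitop /code zip_map -map_comp; apply: eq_map => -[i j] /=.
rewrite (opE orb (ffmax z z')) ?(opE andb (ffmin z z')).
- by rewrite !map_f // mem_enum.
- by move=> i j; rewrite ffunE -leq_min; case: (leqP (z i) (z' i)).
- by move=> i j; rewrite ffunE -leq_max; case: (leqP (z i) (z' i)).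
Qed.

End Daykin.
End FourFunctions.

(** * Order-preserving maps to a long chain *)

Section OrdMaps.
Context {d : Order.disp_t} (P : finPOrderType d) (N : nat).
Local Notation map_ := {ffun P -> 'I_N.+1}.

Definition ord_maps : {set map_} :=
  [set z : map_ | [forall x, forall y, (x <= y)%O ==> (z x <= z y)%N]].

Lemma ord_mapsP (z : map_) :
  reflect (forall x y, (x <= y)%O -> (z x <= z y)%N) (z \in ord_maps).
Proof.
rewrite inE; apply: (iffP forallP) => h x; last by apply/forallP => y; apply/implyP/h.
by move=> y; have /forallP /(_ y) /implyP := h x.
Qed.

Lemma ord_maps_neq0 : ord_maps != set0.
Proof.
by apply/set0Pn; exists [ffun=> ord0]; apply/ord_mapsP => x y _; rewrite !ffunE.
Qed.

Lemma card_ord_maps_gt0 : (0 < #|ord_maps|)%N.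
Proof. by rewrite card_gt0 ord_maps_neq0. Qed.

Definition tail_card (x : P) (t : nat) : nat := #|[set z in ord_maps | (t <= z x)%N]|.

(* Daykin's inequality for the sets of z1 and of z2 + t, inside the maps to
   {0, ..., N + t}: the meet and join are min (z1, z2 + t) and
   max (z1 - t, z2) + t. *)
Lemma tail_card_submul x s t :
  (tail_card x (s + t) * #|ord_maps| <= tail_card x s * tail_card x t)%N.
Proof.
pose lo (z : map_) : {ffun P -> 'I_(N + t).+1} := [ffun y => inord (z y)].
pose hi (z : map_) : {ffun P -> 'I_(N + t).+1} := [ffun y => inord (z y + t)].
have loE z y : nat_of_ord (lo z y) = z y.
  by rewrite ffunE inordK //; have := ltn_ord (z y); lia.
have hiE z y : nat_of_ord (hi z y) = (z y + t)%N.
  by rewrite ffunE inordK //; have := ltn_ord (z y); lia.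
have lo_inj : injective lo.
  move=> z z' h; apply/ffunP => y; apply: val_inj => /=.
  by rewrite -!loE h.
have hi_inj : injective hi.
  move=> z z' h; apply/ffunP => y; apply: val_inj => /=; apply: (@addIn t).
  by rewrite -!hiE h.
have := @daykin _ _ (lo @: [set z in ord_maps | (s + t <= z x)%N]) (hi @: ord_maps)
  (hi @: [set z in ord_maps | (s <= z x)%N]) (lo @: [set z in ord_maps | (t <= z x)%N]).
rewrite !card_imset //; apply.
move=> _ _ /imsetP [z1 + ->] /imsetP [z2 /ord_mapsP m2 ->].
rewrite inE => /andP [/ord_mapsP m1 hz1].
have l1 y y' : (y <= y')%O -> (z1 y <= z1 y')%N by exact: m1.
have l2 y y' : (y <= y')%O -> (z2 y <= z2 y')%N by exact: m2.
pose u : map_ := [ffun y => inord (maxn (z1 y - t) (z2 y))].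
pose v : map_ := [ffun y => inord (minn (z1 y) (z2 y + t))].
have uE y : nat_of_ord (u y) = maxn (z1 y - t) (z2 y).
  by rewrite ffunE inordK //; have := ltn_ord (z1 y); have := ltn_ord (z2 y); lia.
have vE y : nat_of_ord (v y) = minn (z1 y) (z2 y + t).
  by rewrite ffunE inordK //; have := ltn_ord (z1 y); lia.
split; apply/imsetP.
- exists u.
    rewrite inE uE; apply/andP; split; last by lia.
    apply/ord_mapsP => y y' le; rewrite !uE; have := l1 _ _ le; have := l2 _ _ le; lia.
  apply/ffunP => y; rewrite ffunE; apply: val_inj => /=; rewrite (hiE u) uE.
  have a : nat_of_ord (lo z1 y) = z1 y by exact: loE.
  have b : nat_of_ord (hi z2 y) = (z2 y + t)%N by exact: hiE.
  by case: (leqP (lo z1 y) (hi z2 y)) => h; rewrite ?a ?b; move: h; rewrite a b; lia.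
- exists v.
    rewrite inE vE; apply/andP; split; last by lia.
    apply/ord_mapsP => y y' le; rewrite !vE; have := l1 _ _ le; have := l2 _ _ le; lia.
  apply/ffunP => y; rewrite ffunE; apply: val_inj => /=; rewrite (loE v) vE.
  have a : nat_of_ord (lo z1 y) = z1 y by exact: loE.
  have b : nat_of_ord (hi z2 y) = (z2 y + t)%N by exact: hiE.
  by case: (leqP (lo z1 y) (hi z2 y)) => h; rewrite ?a ?b; move: h; rewrite a b; lia.
Qed.

(** Adding [lev x * N.+1] to [z x] places the levels on successive stretches of a longer chain, so
    only relations within a level constrain [z]. Division by [p.+1] returns to the original chain,
    and forgetting the remainders costs the factor [p.+1 ^ #|P|]. *)
Lemma compress (p : nat) (lev : P -> 'I_p.+1) (Xs : {set map_}) :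
  (forall x y, (x <= y)%O -> (lev x <= lev y)%N) ->
  (forall z x y, z \in Xs -> (x <= y)%O -> lev x = lev y -> (z x <= z y)%N) ->
  (#|Xs| <= p.+1 ^ #|P| *
     #|[set z in ord_maps | [forall x, (lev x * N.+1) %/ p.+1 <= z x]]|)%N.
Proof.
move=> lev_mono Xs_mono.
pose num (z : map_) x := (lev x * N.+1 + z x)%N.
pose phi (z : map_) : map_ * {ffun P -> 'I_p.+1} :=
  ([ffun x => inord (num z x %/ p.+1)], [ffun x => inord (num z x %% p.+1)]).
have phi1 z x : nat_of_ord ((phi z).1 x) = (num z x %/ p.+1)%N.
  rewrite ffunE inordK // ltn_divLR // /num.
  have := ltn_ord (lev x); have := ltn_ord (z x); nia.
have phi2 z x : nat_of_ord ((phi z).2 x) = (num z x %% p.+1)%N.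
  by rewrite ffunE inordK // ltn_pmod.
have phi_inj : injective phi.
  move=> z z' h; apply/ffunP => x; apply: val_inj => /=.
  apply: (@addnI (lev x * N.+1)%N); rewrite -!/(num _ x).
  by rewrite (divn_eq (num z x) p.+1) (divn_eq (num z' x) p.+1) -!phi1 -!phi2 h.
have cT : (p.+1 ^ #|P|)%N = #|[set: {ffun P -> 'I_p.+1}]| by rewrite cardsT card_ffun card_ord.
rewrite -(card_imset Xs phi_inj) cT mulnC -cardsX.
apply: subset_leq_card; apply/subsetP => _ /imsetP [z zX ->].
rewrite in_setX [_ \in [set: _]]inE andbT inE; apply/andP; split; last first.
  by apply/forallP => x; rewrite phi1 leq_div2r // leq_addr.
apply/ord_mapsP => x y le; rewrite !phi1 leq_div2r // /num.
have := lev_mono _ _ le; rewrite leq_eqVlt => /orP [/eqP /val_inj e|lt].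
  by rewrite e leq_add2l Xs_mono.
apply: (@leq_trans ((lev x).+1 * N.+1)).
  by rewrite mulSn addnC leq_add2r ltnW.
exact: leq_trans (leq_mul lt (leqnn _)) (leq_addr _ _).
Qed.

(** Compression with two levels, every element being on the upper one. *)
Lemma tail_card_half x : (#|ord_maps| <= 2 ^ #|P| * tail_card x (N.+1 %/ 2))%N.
Proof.
apply: leq_trans (compress (lev := fun=> (inord 1 : 'I_2)) _ _) _ => //.
  by move=> z x' y /ord_mapsP h le _; exact: h.
rewrite leq_pmul2l ?expn_gt0 //; apply: subset_leq_card; apply/subsetP => z.
rewrite !inE => /andP [-> /forallP /(_ x)].
by rewrite inordK // mul1n.
Qed.

(** The largest median of [z x] for uniform [z]. *)
Definition scale (x : P) : nat :=
  \max_(t < N.+1 | (#|ord_maps| <= 2 * tail_card x t)%N) t.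

Lemma leq_tail_card x s t : (s <= t)%N -> (tail_card x t <= tail_card x s)%N.
Proof.
move=> st; apply: subset_leq_card; apply/subsetP => z; rewrite !inE => /andP [-> /=].
exact: leq_trans.
Qed.

Lemma tail_card0 x : tail_card x 0 = #|ord_maps|.
Proof. by apply: eq_card => z; rewrite !inE andbT. Qed.

Lemma scale_tail x : (#|ord_maps| <= 2 * tail_card x (scale x))%N.
Proof.
pose Q := [pred t : 'I_N.+1 | (#|ord_maps| <= 2 * tail_card x t)%N].
have [|t ht e] := @eq_bigmax_cond _ Q (@nat_of_ord N.+1).
  by apply/card_gt0P; exists ord0; rewrite !inE tail_card0; lia.
suff -> : scale x = t by [].
by rewrite -e; apply: eq_bigl => i; rewrite inE.
Qed.

Lemma leq_scale x t : (#|ord_maps| <= 2 * tail_card x t)%N -> (t <= scale x)%N.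
Proof.
move=> h; have tN : (t < N.+1)%N.
  rewrite ltnNge; apply: contraTN h => tN; rewrite -ltnNge.
  rewrite (_ : tail_card x t = 0%N) ?muln0 ?card_ord_maps_gt0 //.
  apply: eq_card0 => z; rewrite !inE; apply/negbTE/negP => /andP [_ h].
  by have := ltn_ord (z x); lia.
exact: (@leq_bigmax_cond _ _ (@nat_of_ord N.+1) (Ordinal tN)).
Qed.

Variable R : realFieldType.
Local Notation Pr := (prob R ord_maps).

Lemma prob_tailE x t : Pr (fun z => (t <= z x)%N) = (tail_card x t)%:R / #|ord_maps|%:R.
Proof. by rewrite probE. Qed.

Lemma prob_tail_submul x s t :
  Pr (fun z => (s + t <= z x)%N) <= Pr (fun z => (s <= z x)%N) * Pr (fun z => (t <= z x)%N).
Proof.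
rewrite !prob_tailE; have h := tail_card_submul x s t.
have O0 : 0 < #|ord_maps|%:R :> R by rewrite ltr0n card_ord_maps_gt0.
rewrite mulrACA -invfM ler_pdivlMr ?mulr_gt0 // mulrA divfK ?gt_eqF //.
by rewrite -!natrM ler_nat.
Qed.

Lemma prob_tail_exp x j t :
  Pr (fun z => (j * t <= z x)%N) <= Pr (fun z => (t <= z x)%N) ^+ j.
Proof.
elim: j => [|j IH]; first by rewrite expr0 prob_le1.
rewrite mulSn exprS; apply: (le_trans (prob_tail_submul _ _ _)).
by rewrite ler_wpM2l // prob_ge0.
Qed.

Lemma prob_ge_scale x j :
  Pr (fun z => (j * (scale x).+1 <= z x)%N) <= 2^-1 ^+ j.
Proof.
apply: (le_trans (prob_tail_exp _ _ _)); rewrite lerXn2r ?nnegrE ?prob_ge0 ?invr_ge0 //.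
rewrite prob_tailE ler_pdivrMr ?ltr0n ?card_ord_maps_gt0 //.
rewrite mulrC ler_pdivlMr // -natrM ler_nat mulnC; apply: ltnW; rewrite ltnNge.
by apply/negP => /leq_scale; rewrite ltnn.
Qed.

(** Bernoulli's inequality for [(1 + p)^j] and [(1 - p)^j * (1 + p)^j <= 1] give
    [1 + j * p <= 2]. *)
Lemma exp_half_le (p : R) j : 0 <= p <= 1 -> 2^-1 <= (1 - p) ^+ j -> j%:R * p <= 1.
Proof.
move=> /andP [p0 p1] h.
have bern : 1 + j%:R * p <= (1 + p) ^+ j.
  elim: j {h} => [|j IH]; first by rewrite mul0r addr0 expr0.
  rewrite exprS -natr1 -[leLHS]subr0.
  apply: le_trans (_ : (1 + p) * (1 + j%:R * p) <= _); last by rewrite ler_wpM2l // addr_ge0.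
  have : 0 <= j%:R * p * p by rewrite !mulr_ge0.
  lra.
have : (1 - p) ^+ j * (1 + p) ^+ j <= 1.
  rewrite -exprMn -[leRHS](expr1n _ j) lerXn2r ?nnegrE ?mulr_ge0 ?subr_ge0 ?addr_ge0 //.
  have : 0 <= p * p by rewrite mulr_ge0.
  lra.
have h2 : 2^-1 * (1 + j%:R * p) <= (1 - p) ^+ j * (1 + p) ^+ j.
  by rewrite ler_pM // ?invr_ge0 // addr_ge0 // mulr_ge0.
move: ((1 - p) ^+ j * (1 + p) ^+ j) h2 => w; lra.
Qed.

(** With [p] the probability of [z x < t], submultiplicativity gives
    [1/2 <= Pr(j * t <= z x) <= (1 - p)^j]. *)
Lemma prob_lt_scale x j t : (j * t <= scale x)%N ->
  j%:R * Pr (fun z => (z x < t)%N) <= 1.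
Proof.
move=> jt; apply: exp_half_le; first by rewrite prob_ge0 prob_le1.
rewrite -prob_not ?ord_maps_neq0 //.
apply: le_trans (_ : Pr (fun z => (j * t <= z x)%N) <= _); last first.
  rewrite (_ : prob _ _ (fun z => ~~ _) = Pr (fun z => (t <= z x)%N)) ?prob_tail_exp //.
  by apply: eq_expect => z _; rewrite -leqNgt.
rewrite prob_tailE ler_pdivlMr ?ltr0n ?card_ord_maps_gt0 // mulrC ler_pdivrMr //.
rewrite -natrM ler_nat mulnC; apply: leq_trans (scale_tail x) _.
by rewrite leq_mul2l leq_tail_card.
Qed.

(** With [n = #|P|], take the [n]-th root of [2^-n <= Pr(n * t <= z x) <= Pr(t <= z x)^n]. *)
Lemma scale_lower x t : (#|P| * t <= N.+1 %/ 2)%N -> (t <= scale x)%N.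
Proof.
move=> nt; apply: leq_scale.
have n0 : (0 < #|P|)%N by apply/card_gt0P; exists x.
have h := tail_card_half x.
have O0 : 0 < #|ord_maps|%:R :> R by rewrite ltr0n card_ord_maps_gt0.
have : 2^-1 ^+ #|P| <= Pr (fun z => (t <= z x)%N) ^+ #|P|.
  apply: le_trans (prob_tail_exp _ _ _).
  rewrite prob_tailE ler_pdivlMr // exprVn mulrC ler_pdivrMr ?exprn_gt0 //.
  rewrite -natrX -natrM ler_nat mulnC; apply: leq_trans h _.
  by rewrite leq_mul2l leq_tail_card ?orbT.
rewrite ler_pXn2r ?nnegrE ?prob_ge0 ?invr_ge0 //.
by rewrite prob_tailE ler_pdivlMr // mulrC ler_pdivrMr // -natrM ler_nat mulnC.
Qed.

End OrdMaps.

(** * Resampling one coordinate *)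

Lemma card_divn_eq (N b q : nat) : (0 < b)%N ->
  (#|[set a : 'I_N | (a %/ b == q)%N]| <= b)%N.
Proof.
case: b => // b _.
have inj : {in [set a : 'I_N | (a %/ b.+1 == q)%N] &,
    injective (fun a : 'I_N => inord (a %% b.+1) : 'I_b.+1)}.
  move=> a a'; rewrite !inE => /eqP qa /eqP qa' /(congr1 (@nat_of_ord _)).
  rewrite !inordK ?ltn_pmod // => r; apply: val_inj => /=.
  by rewrite (divn_eq a b.+1) (divn_eq a' b.+1) qa qa' r.
by rewrite -(card_in_imset inj) -[leqRHS]card_ord max_card.
Qed.

Section Resample.
Context {d : Order.disp_t} (P : finPOrderType d) (N : nat).
Local Notation map_ := {ffun P -> 'I_N.+1}.
Local Notation O := (ord_maps P N).

Definition upd (z : map_) (x : P) (a : 'I_N.+1) : map_ :=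
  [ffun y => if y == x then a else z y].

Definition slack (x : P) (z : map_) : nat := #|[set a | upd z x a \in O]|.

Lemma upd_upd z x a b : upd (upd z x a) x b = upd z x b.
Proof. by apply/ffunP => y; rewrite !ffunE; case: eqP. Qed.

Lemma upd_id z x : upd z x (z x) = z.
Proof. by apply/ffunP => y; rewrite !ffunE; case: eqP => [->|]. Qed.

(** Double counting of pairs of a map and an admissible new value at [x]. Exchanging the old and new
    values is an involution, [psi]; afterwards the stored value lies in the bin of [z y], which
    leaves at most [b] choices. *)
Lemma collision_count (x y : P) (b t : nat) : x != y -> (0 < b)%N ->
  (t * #|[set z in O | (t <= slack x z) && (z x %/ b == z y %/ b)]| <= b * #|O|)%N.
Proof.
move=> nxy b0.
pose S1 := [set p : map_ * 'I_N.+1 | [&& p.1 \in O, upd p.1 x p.2 \in O &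
  (p.1 x %/ b == p.1 y %/ b)%N]].
pose S2 := [set p : map_ * 'I_N.+1 | (p.1 \in O) && (p.2 %/ b == p.1 y %/ b)%N].
have cardE (Q : pred (map_ * 'I_N.+1)) :
    #|[set p | Q p]| = (\sum_z #|[set a | Q (z, a)]|)%N.
  rewrite -sum1_card big_mkcond /=.
  transitivity (\sum_(z : map_) \sum_(a : 'I_N.+1) (Q (z, a) : nat))%N.
    rewrite pair_bigA; apply: eq_bigr => -[z a] _; rewrite inE /=; by case: (Q _).
  apply: eq_bigr => z _; rewrite -sum1_card [RHS]big_mkcond; apply: eq_bigr => a _.
  by rewrite inE; case: (Q _).
apply: (@leq_trans #|S1|).
  rewrite cardE mulnC -sum_nat_const big_mkcond; apply: leq_sum => z _ /=.
  rewrite inE; case: ifP => // /and3P [zO st bin].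
  apply: leq_trans st _; apply: subset_leq_card; apply/subsetP => a.
  by rewrite inE => ha; rewrite inE /= zO bin ha.
pose psi (p : map_ * 'I_N.+1) := (upd p.1 x p.2, p.1 x).
have psi_inj : injective psi.
  apply: (can_inj (g := psi)) => -[z a]; rewrite /psi /= upd_upd upd_id.
  by rewrite ffunE eqxx.
rewrite -(card_imset S1 psi_inj); apply: (@leq_trans #|S2|).
  apply: subset_leq_card; apply/subsetP => _ /imsetP [p + ->].
  rewrite inE => /and3P [_ hp /eqP bin]; rewrite inE /= hp bin.
  by rewrite ffunE [y == x]eq_sym (negbTE nxy) eqxx.
rewrite cardE mulnC -sum_nat_const [leqRHS]big_mkcond; apply: leq_sum => z _ /=.
case: ifP => zO; first exact: card_divn_eq.
rewrite leqn0; apply/eqP/eq_card0 => a; apply/negbTE/negP.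
by rewrite inE => /andP [/= h _]; rewrite h in zO.
Qed.

(** A minimal element can be lowered freely: all of [0, ..., z x] are admissible. *)
Lemma slack_minimal x z : z \in O -> (forall y, ~~ (y < x)%O) -> (z x < slack x z)%N.
Proof.
move=> /ord_mapsP zO xmin.
have inj : injective (fun i : 'I_(z x).+1 => inord i : 'I_N.+1).
  move=> i j /(congr1 (@nat_of_ord _)); have := ltn_ord (z x) => zx.
  rewrite !inordK; first exact: val_inj.
    exact: leq_trans (ltn_ord j) zx.
  exact: leq_trans (ltn_ord i) zx.
rewrite -[X in (X <= _)%N]card_ord -(card_imset _ inj).
apply: subset_leq_card; apply/subsetP => _ /imsetP [i _ ->]; rewrite inE.
have ix : (i <= z x)%N by rewrite -ltnS.
have iN : (i < N.+1)%N by apply: leq_ltn_trans ix _.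
apply/ord_mapsP => u v uv; rewrite !ffunE.
have [ux|nux] := eqVneq u x; have [vx|nvx] := eqVneq v x => //.
- have xv : (x <= v)%O by rewrite -[X in (X <= v)%O]ux.
  by rewrite inordK // (leq_trans ix) // zO.
- have ux : (u <= x)%O by rewrite -[X in (u <= X)%O]vx.
  by have := xmin u; rewrite lt_neqAle nux ux.
- exact: zO.
Qed.

Variable R : realFieldType.
Local Notation Pr := (prob R O).

Lemma prob_collision (x y : P) (b t : nat) : x != y -> (0 < b)%N -> (0 < t)%N ->
  Pr (fun z => z x %/ b == z y %/ b)%N <=
  Pr (fun z => slack x z < t)%N + b%:R / t%:R.
Proof.
move=> nxy b0 t0.
apply: (@le_trans _ _ (Pr (fun z => (slack x z < t)%N ||
    ((t <= slack x z) && (z x %/ b == z y %/ b))%N))).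
  by apply: ler_prob => z _ ->; rewrite andbT ltnNge orNb.
apply: (le_trans (prob_or _ _ _ _)); rewrite lerD2l [X in X <= _]probE.
rewrite ler_pdivrMr ?ltr0n ?card_ord_maps_gt0 // mulrAC ler_pdivlMr ?ltr0n //.
by rewrite -!natrM ler_nat mulnC collision_count.
Qed.

Lemma prob_slack_minimal x t : (forall y, ~~ (y < x)%O) ->
  Pr (fun z => slack x z < t)%N <= Pr (fun z => z x < t)%N.
Proof.
move=> xmin; apply: ler_prob => z zO h.
exact: ltn_trans (slack_minimal zO xmin) h.
Qed.

End Resample.

(** * Nearly uniform families from large slack *)

Section Families.
Variable R : archiRealFieldType.

(** Bins have width [b], with an overflow bin of index [B]. A collision either has [z u >= b * B] or
    is a collision of intervals of width [b], of probability at most [Pr(slack < t) + b/t]; each of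
    the three terms is at most a third of the allowed bound. *)
Lemma slack_family (k : nat) (eps : R) : 0 < eps ->
  exists2 e : R, 0 < e & forall B, exists L,
    forall (d : Order.disp_t) (P : finPOrderType d) (N : nat) (s : seq P) (b t : nat),
    uniq s -> (L <= size s)%N -> (0 < b)%N -> (0 < t)%N -> b%:R <= e * t%:R ->
    (forall x, x \in s -> prob R (ord_maps P N) (fun z => slack x z < t)%N <= e) ->
    (forall x, x \in s -> prob R (ord_maps P N) (fun z => b * B <= z x)%N <= e) ->
    exists Y : seq P, [/\ subseq Y s, size Y = k & forall l, perm_eq l Y ->
      k`!%:R^-1 - eps <=
        prob R (ord_maps P N) (fun z => sorted ltn [seq nat_of_ord (z v) | v <- l])].
Proof.
move=> eps0; have [e e0 he] := nearly_uniform_orderings k eps0.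
exists (e / 3); first by rewrite divr_gt0.
move=> B; have [L hL] := he B.+1; exists L => d P N s b t us hs b0 t0 bt hslack hbig.
pose X (v : P) (z : {ffun P -> 'I_N.+1}) : 'I_B.+1 := inord (minn (z v %/ b) B).
have XE v z : nat_of_ord (X v z) = minn (z v %/ b) B.
  by rewrite inordK // ltnS geq_minr.
have [|Y [sub sz hY]] := hL _ (ord_maps P N) _ s X (ord_maps_neq0 P N) us hs.
  move=> u v us' vs nuv.
  apply: (@le_trans _ _ (prob R (ord_maps P N) (fun z => (b * B <= z u)%N ||
     (z u %/ b == z v %/ b)%N))).
    apply: ler_prob => z _ /eqP /(congr1 (@nat_of_ord _)); rewrite !XE => h.
    case: leqP => //= lt; apply/eqP.
    have lt' : (z u %/ b < B)%N by rewrite ltn_divLR // mulnC.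
    by move: h lt'; move: (z u %/ b)%N (z v %/ b)%N => p q; lia.
  apply: (le_trans (prob_or _ _ _ _)).
  have h1 := hbig u us'; have h2 := hslack u us'.
  have h3 := prob_collision N R nuv b0 t0.
  have h4 : b%:R / t%:R <= e / 3 by rewrite ler_pdivrMr ?ltr0n.
  apply: (le_trans (lerD h1 h3)); lra.
(* Strictly increasing bins, even truncated at [B], force strictly increasing values. *)
exists Y; split=> // l pl; apply: (le_trans (hY l pl)); apply: ler_prob => z _.
rewrite !sorted_map; apply: sub_sorted => u v /=; rewrite !XE => h.
rewrite ltnNge; apply/negP => /(leq_div2r b); move: h.
by move: (z u %/ b)%N (z v %/ b)%N => p q; lia.
Qed.

(** Take bins of width [b], about [S / J^2], and slack threshold [b * J]. Since [J * (b * J) <= S],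
    [z x] falls below the threshold with probability at most [1/J]; it reaches [J * (scale N x).+1]
    with probability at most [2^-J]. *)
Lemma minimal_family (k : nat) (eps : R) : 0 < eps -> exists L S0,
    forall (d : Order.disp_t) (P : finPOrderType d) (N : nat) (s : seq P) (S : nat),
    uniq s -> (L <= size s)%N -> (S0 <= S)%N ->
    (forall x, x \in s -> forall y, ~~ (y < x)%O) ->
    (forall x, x \in s -> (S <= scale N x < 2 * S)%N) ->
    exists Y : seq P, [/\ subseq Y s, size Y = k & forall l, perm_eq l Y ->
      k`!%:R^-1 - eps <=
        prob R (ord_maps P N) (fun z => sorted ltn [seq nat_of_ord (z v) | v <- l])].
Proof.
move=> eps0; have [e e0 he] := slack_family k eps0.
have [J J0 hJ] := ex_inv_le e0.
have JR : 0 < J%:R :> R by rewrite ltr0n.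
have J1 : 1 <= e * J%:R by rewrite -ler_pdivrMr // div1r.
(* With [b > 0], which [S >= J * J] ensures, [S < 2 * b * J^2]; so [4 * J ^ 3] bins reach
   [2 * J * S]. *)
have [L hL] := he (4 * J ^ 3)%N.
exists L, (J * J)%N => d P N s S us hs hS smin hscale.
pose b := (S %/ (J * J))%N.
have JJ0 : (0 < J * J)%N by rewrite muln_gt0 J0.
have b0 : (0 < b)%N by rewrite divn_gt0.
have bS : (b * (J * J) <= S)%N by exact: leq_trunc_div.
have Sb : (S < b.+1 * (J * J))%N by rewrite ltn_ceil.
apply: (hL d P N s b (b * J)%N) => //.
- by rewrite muln_gt0 b0.
- by rewrite natrM mulrCA ler_peMr.
- move=> x xs; apply: le_trans hJ.
  apply: le_trans (prob_slack_minimal _ _ _ (smin x xs)) _.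
  rewrite -[J%:R^-1]mul1r ler_pdivlMr // mulrC.
  apply: prob_lt_scale; have /andP [h _] := hscale x xs.
  by apply: leq_trans h; apply: leq_trans bS; rewrite mulnCA.
- move=> x xs; apply: le_trans hJ; apply: (@le_trans _ _ (2^-1 ^+ J)); last first.
    rewrite exprVn lef_pV2 ?posrE ?exprn_gt0 // -natrX ler_nat.
    exact: ltnW (ltn_expl _ _).
  apply: le_trans (prob_ge_scale N R x J); apply: ler_prob => z _.
  apply: leq_trans; have /andP [_ h] := hscale x xs.
  have h1 : (2 * S <= 4 * (b * (J * J)))%N.
    have : (b.+1 * (J * J) <= 2 * b * (J * J))%N.
      by rewrite leq_mul2r; apply/orP; right; lia.
    by rewrite -mulnA; move: Sb; lia.
  apply: (@leq_trans (J * (4 * (b * (J * J)))))%N.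
    by rewrite leq_mul2l (leq_trans h h1) orbT.
  by rewrite !expnS expn0 muln1; nia.
Qed.

End Families.

(** * Slack on a large antichain *)

Lemma antichainP {d : Order.disp_t} (P : finPOrderType d) (A : {set P}) x y :
  antichain A -> x \in A -> y \in A -> ~~ (x < y)%O.
Proof.
move=> /forallP /(_ x) /implyP hA xA yA.
have /forallP /(_ y) /implyP /(_ yA) /implyP h := hA xA.
have [->|nxy] := eqVneq x y; first by rewrite ltxx.
by have := h nxy; apply: contra => /ltW le; rewrite /Order.comparable le.
Qed.

Section Antichain.
Context {d : Order.disp_t} (P : finPOrderType d) (N : nat) (A : {set P}).
Hypothesis acA : antichain A.
Local Notation map_ := {ffun P -> 'I_N.+1}.
Local Notation O := (ord_maps P N).

(** Compression along these levels makes room for [A]: what lies strictly below [A] goes to the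
    bottom third of the chain, [A] to the middle, the rest to the top. *)
Definition level (x : P) : 'I_3 :=
  if x \in A then inord 1 else
  if [exists a in A, (x < a)%O] then ord0 else inord 2.

Lemma level_mono x y : (x <= y)%O -> (level x <= level y)%N.
Proof.
rewrite le_eqVlt => /orP [/eqP -> //|xy]; rewrite /level.
have [yA|yA] := boolP (y \in A).
  have [xA|_] := boolP (x \in A); first by have := antichainP acA xA yA; rewrite xy.
  by have -> : [exists a in A, (x < a)%O] by apply/exists_inP; exists y.
have [/exists_inP [a aA ya]|_] := boolP [exists a in A, (y < a)%O].
  have xa : (x < a)%O := lt_trans xy ya.
  have [xA|_] := boolP (x \in A); first by have := antichainP acA xA aA; rewrite xa.
  by have -> : [exists a in A, (x < a)%O] by apply/exists_inP; exists a.
by case: ifP => _; [|case: ifP => _]; rewrite ?inordK.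
Qed.

(** Values on [A] are unconstrained, so each fibre over the values off [A] is a full power of the
    chain, against which gaps are measured. *)
Definition free_maps : {set map_} := [set z : map_ |
  [forall x, forall y, [&& x \notin A, y \notin A & (x <= y)%O] ==> (z x <= z y)%N]].

(** Compression by [level]: the outer levels are disjoint from [A] and the middle one is an
    antichain, so free maps are monotone within levels. *)
Lemma card_free_maps : (#|free_maps| <= 3 ^ #|P| * #|O|)%N.
Proof.
apply: leq_trans (compress (lev := level) level_mono _) _.
  move=> z x y; rewrite inE => /forallP /(_ x) /forallP /(_ y) /implyP h xy lev.
  have [xA|xA] := boolP (x \in A); last first.
    apply: h; rewrite xA xy andbT /=; apply: contraNN xA => yA.
    move: lev; rewrite /level yA; case: (x \in A) => //.
    by case: ifP => _ /(congr1 (@nat_of_ord _)); rewrite !inordK.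
  have yA : y \in A.
    apply/negPn/negP => yA; move: lev; rewrite /level xA (negbTE yA).
    by case: ifP => _ /(congr1 (@nat_of_ord _)); rewrite !inordK.
  move: xy; rewrite le_eqVlt (negbTE (antichainP acA xA yA)) orbF => /eqP -> //.
by rewrite leq_mul2l subset_leq_card ?orbT //; apply/subsetP => z; rewrite inE => /andP [].
Qed.

(** Only elements strictly comparable to [x] enter, so for [x] in [A] the gap is a function of the
    coordinates off [A]. *)
Definition gap (x : P) (z : map_) : {set 'I_N.+1} := [set a : 'I_N.+1 |
  [forall y, ((y < x)%O ==> (z y <= a)%N) && ((x < y)%O ==> (a <= z y)%N)]].

Lemma gapP x (z : map_) (a : 'I_N.+1) :
  reflect (forall y, ((y < x)%O -> (z y <= a)%N) /\ ((x < y)%O -> (a <= z y)%N))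
    (a \in gap x z).
Proof.
rewrite inE; apply: (iffP forallP) => h y.
  by have /andP [/implyP ? /implyP ?] := h y.
by have [? ?] := h y; apply/andP; split; apply/implyP.
Qed.

Lemma gap_slack x z : z \in O -> (#|gap x z| <= slack x z)%N.
Proof.
move=> /ord_mapsP zO; apply: subset_leq_card; apply/subsetP => a /gapP h.
rewrite inE; apply/ord_mapsP => u v uv; rewrite !ffunE.
have [ux|nux] := eqVneq u x; have [vx|nvx] := eqVneq v x => //.
- by apply: (h v).2; rewrite lt_neqAle eq_sym nvx -ux.
- by apply: (h u).1; rewrite lt_neqAle nux -vx.
- exact: zO.
Qed.

Lemma gap_eq x (z z' : map_) : x \in A -> (forall y, y \notin A -> z y = z' y) ->
  gap x z = gap x z'.
Proof.
move=> xA h; apply/setP => a; apply/gapP/gapP => hy y;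
  have [h1 h2] := hy y; split=> lt.
- by rewrite -h ?h1 //; apply: contraTN lt => yA; exact: (antichainP acA).
- by rewrite -h ?h2 //; apply: contraTN lt => yA; exact: (antichainP acA).
- by rewrite h ?h1 //; apply: contraTN lt => yA; exact: (antichainP acA).
- by rewrite h ?h2 //; apply: contraTN lt => yA; exact: (antichainP acA).
Qed.

Lemma card_familyE (F : P -> {set 'I_N.+1}) :
  #|[set z : map_ | [forall x, z x \in F x]]| = (\prod_x #|F x|)%N.
Proof.
transitivity #|(family F : simpl_pred map_)|.
  by apply: eq_card => z; rewrite inE; apply/forallP/familyP.
by rewrite card_family foldrE big_map big_enum.
Qed.

(** Fixing the coordinates off [A] fixes all gaps on [A]. In such a fibre the order-preserving maps
    lie in the product of the gaps, while the free maps fill the product of full chains; [r] gaps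
    shorter than [t] make the ratio at most [(t / N.+1)^r]. *)
Lemma card_small_gaps (r t : nat) : (t <= N.+1)%N ->
  (#|[set z in O | (r <= #|[set x in A | (#|gap x z| < t)%N]|)%N]| * N.+1 ^ r
    <= t ^ r * #|free_maps|)%N.
Proof.
move=> tN; set Bd := [set z in O | _].
pose pr (z : map_) : map_ := [ffun x => if x \in A then ord0 else z x].
have prP (z z' : map_) : pr z = pr z' -> forall y, y \notin A -> z y = z' y.
  move=> h y yA; have /(congr1 (fun f : map_ => f y)) := h.
  by rewrite !ffunE (negbTE yA).
rewrite -!sum1_card (partition_big pr predT) //= [leqRHS]mulnC.
rewrite [in leqRHS](partition_big pr predT) //= !big_distrl /=.
apply: leq_sum => g _; rewrite !sum1_card.
set K := #|_|; case: (posnP K) => [-> //|].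
move=> /card_gt0P [z0]; rewrite unfold_in => /andP [z0B /eqP z0g].
have /andP [/ord_mapsP z0O hr] : (z0 \in O) && (r <= #|[set x in A | (#|gap x z0| < t)%N]|)%N.
  by move: z0B; rewrite inE.
set S := [set x in A | (#|gap x z0| < t)%N] in hr.
pose F x := if x \in A then gap x z0 else [set z0 x].
pose F' x := if x \in A then [set: 'I_N.+1] else [set z0 x].
have cT : #|[set: 'I_N.+1]| = N.+1 by rewrite cardsT card_ord.
apply: (@leq_trans ((\prod_x #|F x|) * N.+1 ^ r)).
  rewrite leq_mul2r -card_familyE; apply/orP; right.
  apply: subset_leq_card; apply/subsetP => z; rewrite unfold_in => /andP [zB /eqP zg].
  have /ord_mapsP zO : z \in O by move: zB; rewrite inE => /andP [].
  have zz0 := prP _ _ (etrans zg (esym z0g)).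
  rewrite inE; apply/forallP => x; rewrite /F; case: ifP => xA; last first.
    by rewrite inE zz0 ?xA.
  rewrite -(gap_eq xA zz0); apply/gapP => y; split=> /ltW; exact: zO.
apply: (@leq_trans (t ^ r * \prod_x #|F' x|)); last first.
  rewrite mulnC leq_mul2r -card_familyE; apply/orP; right.
  apply: subset_leq_card; apply/subsetP => z; rewrite inE => /forallP zF'.
  have zz0 y : y \notin A -> z y = z0 y.
    by move=> yA; have := zF' y; rewrite /F' (negbTE yA) inE => /eqP.
  rewrite unfold_in; apply/andP; split; last first.
    by rewrite -z0g; apply/eqP/ffunP => x; rewrite !ffunE; case: ifPn => // /zz0.
  rewrite inE; apply/forallP => x; apply/forallP => y; apply/implyP => /and3P [xA yA xy].
  by rewrite !zz0 //; exact: z0O.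
have SE x : x \in S -> (x \in A) && (#|gap x z0| < t)%N by rewrite inE.
rewrite (bigID (mem S)) [in leqRHS](bigID (mem S)) /=.
have h1 : (\prod_(x in S) #|F x| <= t ^ #|S|)%N.
  rewrite -prod_nat_const; apply: leq_prod => x /SE /andP [xA h].
  by rewrite /F xA ltnW.
have h2 : (\prod_(x | x \notin S) #|F x| <= \prod_(x | x \notin S) #|F' x|)%N.
  apply: leq_prod => x _; rewrite /F /F'; case: ifP => // _.
  by rewrite subset_leq_card // subsetT.
have h3 : (\prod_(x in S) #|F' x| = N.+1 ^ #|S|)%N.
  rewrite -prod_nat_const; apply: eq_bigr => x /SE /andP [xA _].
  by rewrite /F' xA cT.
apply: leq_trans (leq_mul (leq_mul h1 h2) (leqnn _)) _.
rewrite h3 -(subnK hr) !expnD.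
have h4 : (t ^ (#|S| - r) <= N.+1 ^ (#|S| - r))%N.
  by case: (#|S| - r)%N => // u; rewrite leq_exp2r.
move: (\prod_(x | x \notin S) #|F' x|)%N => K'.
have := leq_mul h4 (leqnn (t ^ r * K' * N.+1 ^ r)%N).
move: (t ^ (#|S| - r))%N (N.+1 ^ (#|S| - r))%N (t ^ r)%N (N.+1 ^ r)%N => p q u v; lia.
Qed.

Variable R : realFieldType.

Lemma prob_small_slacks (r t : nat) : (t <= N.+1)%N ->
  prob R O (fun z => r <= #|[set x in A | (slack x z < t)%N]|)%N <=
    3 ^+ #|P| * (t%:R / N.+1%:R) ^+ r.
Proof.
move=> tN; rewrite probE ler_pdivrMr ?ltr0n ?card_ord_maps_gt0 //.
rewrite expr_div_n mulrA mulrAC ler_pdivlMr ?exprn_gt0 ?ltr0n //.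
rewrite -!natrX -!natrM ler_nat mulnAC.
apply: (@leq_trans (t ^ r * #|free_maps|)); last first.
  by rewrite mulnC leq_mul2r card_free_maps orbT.
apply: leq_trans (card_small_gaps r tN); rewrite leq_mul2r; apply/orP; right.
apply: subset_leq_card; apply/subsetP => z; rewrite inE => /andP [zO hr].
rewrite inE zO /=; apply: leq_trans hr _; apply: subset_leq_card.
apply/subsetP => x; rewrite !inE => /andP [-> /=]; apply: leq_ltn_trans.
exact: gap_slack.
Qed.

End Antichain.

Section AntichainFamily.
Variable R : archiRealFieldType.

(* If fewer than [r = e |A| / 4] elements of [A] typically have small slack,
   at least half of [A] has small slack with probability at most [e]. *)
Lemma antichain_family (k : nat) (eps c : R) : 0 < eps -> 0 < c -> exists n0 N0,
    forall (d : Order.disp_t) (P : finPOrderType d) (A : {set P}) (N : nat),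
    antichain A -> c * #|P|%:R <= #|A|%:R -> (n0 <= #|P|)%N -> (N0 <= N)%N ->
    exists Y : seq P, [/\ uniq Y, size Y = k & forall l, perm_eq l Y ->
      k`!%:R^-1 - eps <=
        prob R (ord_maps P N) (fun z => sorted ltn [seq nat_of_ord (z v) | v <- l])].
Proof.
move=> eps0 c0; have [e e0 he] := slack_family k eps0.
have [J J0 hJ] := ex_inv_le e0.
(* This gives [n <= q * r] for [n = #|P|]; with [t] about [N / 6^q], the bound [3^n * (t / N.+1)^r]
   is then at most [3^n * 6^-n = 2^-n]. *)
have [q q0 hq] : exists2 q : nat, (0 < q)%N & q%:R^-1 <= e / 4 * c.
  by apply: ex_inv_le; rewrite mulr_gt0 ?divr_gt0.
have [n1 n10 hn1] : exists2 n1 : nat, (0 < n1)%N & n1%:R^-1 <= e / 4.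
  by apply: ex_inv_le; rewrite divr_gt0.
have [L hL] := he (4 * J * 6 ^ q)%N.
have [n2 n20 hn2] : exists2 n2 : nat, (0 < n2)%N & n2%:R^-1 <= c / (2 * L.+1%:R).
  by apply: ex_inv_le; rewrite divr_gt0 ?mulr_gt0 ?ltr0n.
exists (maxn n1 n2), (J * 6 ^ q)%N => d P A N acA cA; rewrite geq_max => /andP [nn1 nn2] hN.
set n := #|P| in cA nn1 nn2.
have n0R : 0 < n%:R :> R by rewrite ltr0n (leq_trans n10).
have A0R : 0 < #|A|%:R :> R by apply: lt_le_trans cA; rewrite mulr_gt0.
pose r := (Num.truncn (e / 4 * #|A|%:R)).+1.
have rA0 : 0 <= e / 4 * #|A|%:R by rewrite mulr_ge0 ?divr_ge0 // ltW.
have /andP [r1 r2] := truncn_itv rA0.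
have nqr : (n <= q * r)%N.
  have qR : 0 < q%:R :> R by rewrite ltr0n.
  rewrite -(ler_nat R) natrM mulrC -ler_pdivrMr //.
  apply: ltW; apply: le_lt_trans r2.
  apply: (@le_trans _ _ (e / 4 * (c * n%:R))).
    by rewrite mulrA [leLHS]mulrC ler_wpM2r // ltW.
  by rewrite ler_wpM2l // divr_ge0 // ltW.
pose t := (N.+1 %/ 6 ^ q)%N.
have q6 : (0 < 6 ^ q)%N by rewrite expn_gt0.
have Jt : (J <= t)%N by rewrite leq_divRL // (leq_trans hN).
have t0 : (0 < t)%N by apply: leq_trans Jt.
have tN : (t <= N.+1)%N by exact: leq_div.
have tN6 : (t * 6 ^ q <= N.+1)%N by exact: leq_trunc_div.
have Nt6 : (N.+1 < t.+1 * 6 ^ q)%N by rewrite ltn_ceil.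
have bad : prob R (ord_maps P N) (fun z => r <= #|[set x in A | (slack x z < t)%N]|)%N <= e / 4.
  apply: le_trans (prob_small_slacks acA R r tN) _.
  apply: le_trans hn1; apply: (@le_trans _ _ (n%:R^-1)); last first.
    by rewrite lef_pV2 ?posrE ?ltr0n ?(leq_trans n10) // ler_nat.
  apply: (@le_trans _ _ (2^-1 ^+ n)); last first.
    rewrite exprVn lef_pV2 ?posrE ?exprn_gt0 // -natrX ler_nat; exact: ltnW (ltn_expl _ _).
  apply: (@le_trans _ _ (3 ^+ n * 6^-1 ^+ n)).
    rewrite ler_wpM2l ?exprn_ge0 //.
    apply: (@le_trans _ _ ((6^-1 ^+ q) ^+ r)).
      rewrite lerXn2r ?nnegrE ?divr_ge0 ?exprn_ge0 ?invr_ge0 //.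
      rewrite ler_pdivrMr ?ltr0n // exprVn mulrC ler_pdivlMr ?exprn_gt0 //.
      by rewrite -natrX -natrM ler_nat.
    rewrite -exprM; apply: ler_wiXn2l => //; rewrite ?invr_ge0 //; lra.
  by rewrite -exprMn (_ : 3 * 6^-1 = 2^-1 :> R) //; field.
pose G := [set x in A | prob R (ord_maps P N) (fun z => slack x z < t)%N <= e].
(* The number of elements of [A] with small slack is at most [e * #|A| / 4], except on an event of
   probability at most [e / 4], where it is at most [#|A|]. *)
have sumA : \sum_(x in A) prob R (ord_maps P N) (fun z => slack x z < t)%N <= e / 2 * #|A|%:R.
  rewrite -(expect_sum (ord_maps P N) _ _ (fun x z => (slack x z < t)%N%:R)).
  apply: (@le_trans _ _ (expect (ord_maps P N) (fun z => e / 4 * #|A|%:R + #|A|%:R *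
      (r <= #|[set x in A | (slack x z < t)%N]|)%N%:R))).
    apply: ler_expect => z _; rewrite -natr_sum.
    have -> : (\sum_(x in A) (slack x z < t) = #|[set x in A | (slack x z < t)%N]|)%N.
      rewrite -sum1_card [RHS]big_mkcond [LHS]big_mkcond; apply: eq_bigr => x _.
      by rewrite inE; case: (x \in A) => //=; case: ltnP.
    have [h|h] := leqP r #|[set x in A | (slack x z < t)%N]|.
      rewrite mulr1 ler_wpDl // ler_nat; apply: subset_leq_card.
      by apply/subsetP => x; rewrite inE => /andP [].
    by rewrite mulr0 addr0; apply: le_trans r1; rewrite ler_nat -ltnS.
  rewrite expectD expect_cst ?ord_maps_neq0 // expectZ -/(prob R _ _).
  have : #|A|%:R * prob R (ord_maps P N) (fun z => r <= #|[set x in A | (slack x z < t)%N]|)%N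
     <= #|A|%:R * (e / 4) by rewrite ler_wpM2l.
  lra.
(* Markov's inequality over [A]: each element outside [G] contributes more than [e] to the sum. *)
have GA : #|A|%:R <= 2 * #|G|%:R :> R.
  have h1 : e * (#|A|%:R - #|G|%:R) <= e / 2 * #|A|%:R.
    apply: le_trans sumA.
    apply: (@le_trans _ _ (\sum_(x in A) e * (x \notin G)%:R)).
      rewrite -mulr_sumr ler_wpM2l ?(ltW e0) // -natr_sum lerBlDr -natrD ler_nat.
      have -> : (#|G| = \sum_(x in A) (x \in G))%N.
        rewrite -sum1_card [LHS]big_mkcond [RHS]big_mkcond; apply: eq_bigr => x _.
        by rewrite inE; case: (x \in A) => //=; case: (_ <= _).
      rewrite -big_split /= -sum1_card; apply: leq_sum => x _.
      by case: (x \in G).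
    apply: ler_sum => x xA; rewrite inE xA /=.
    have [h|h] := boolP (prob R (ord_maps P N) (fun z => slack x z < t)%N <= e).
      by rewrite mulr0 prob_ge0.
    by rewrite mulr1 ltW // ltNge.
  have h2 : #|A|%:R - #|G|%:R <= #|A|%:R / 2 :> R.
    rewrite -(ler_pM2l e0); apply: le_trans h1 _.
    by rewrite mulrAC mulrA.
  lra.
have LG : (L <= size (enum G))%N.
  rewrite -cardE -(ler_nat R); apply: (@le_trans _ _ (L.+1%:R)); first by rewrite ler_nat.
  suff : 2 * L.+1%:R <= c * n%:R :> R by lra.
  have h : n%:R^-1 <= c / (2 * L.+1%:R).
    apply: le_trans hn2; rewrite lef_pV2 ?posrE ?ltr0n ?(leq_trans n20) // ler_nat //.
  move: h; rewrite ler_pdivlMr ?mulr_gt0 ?ltr0n // mulrC ler_pdivrMr //.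
have b0 : (0 < t %/ J)%N by rewrite divn_gt0.
have bt : ((t %/ J) * J <= t)%N by exact: leq_trunc_div.
have tb : (t < (t %/ J).+1 * J)%N by rewrite ltn_ceil.
have [|||Y [sub sz hY]] := hL d P N (enum G) (t %/ J)%N t (enum_uniq _) LG b0 t0.
- apply: (@le_trans _ _ (e * (t %/ J * J)%N%:R)); last by rewrite ler_wpM2l ?ler_nat // ltW.
  have J1 : 1 <= e * J%:R by rewrite -ler_pdivrMr ?ltr0n // div1r.
  by rewrite natrM mulrCA ler_peMr.
- move=> x; by rewrite mem_enum inE => /andP [].
(* The bins cover the whole chain, so the overflow bin is never reached. *)
- move=> x _; rewrite /prob (eq_expect (G := fun=> 0)) ?expect_cst ?ord_maps_neq0 ?ltW //.
  move=> z _; rewrite leqNgt; suff -> : (z x < t %/ J * (4 * J * 6 ^ q))%N by [].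
  apply: leq_trans (ltn_ord _) _.
  have h1 : (t.+1 * 6 ^ q <= (2 * t) * 6 ^ q)%N by rewrite leq_mul2r mul2n -addnn -[t.+1]addn1 leq_add2l t0 orbT.
  have h2 : (t <= 2 * (t %/ J * J))%N.
    apply: leq_trans (ltnW tb) _; rewrite mulnA leq_mul2r mul2n -addnn.
    by rewrite -[(t %/ J).+1]addn1 leq_add2l b0 orbT.
  apply: (@leq_trans ((2 * t) * 6 ^ q)%N); first exact: leq_trans (ltnW Nt6) h1.
  apply: (@leq_trans ((2 * (2 * (t %/ J * J))) * 6 ^ q)%N); first by rewrite leq_mul2r leq_mul2l h2 !orbT.
  rewrite [leqRHS]mulnA leq_mul2r; apply/orP; right.
  by rewrite [leqRHS]mulnCA [leqLHS]mulnA.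
by exists Y; split=> //; exact: subseq_uniq sub (enum_uniq _).
Qed.

End AntichainFamily.

(** * Injective order-preserving maps and linear extensions *)

Lemma sorted_enum_ord (n : nat) (A : {set 'I_n}) :
  sorted (fun i j : 'I_n => (i < j)%N) (enum A).
Proof.
rewrite /enum_mem -enumT; apply: sorted_filter => [j i l|]; first exact: ltn_trans.
by have := iota_ltn_sorted 0 n; rewrite -val_enum_ord sorted_map.
Qed.

Section Injective.
Context {d : Order.disp_t} (P : finPOrderType d) (N : nat).
Local Notation map_ := {ffun P -> 'I_N.+1}.
Local Notation O := (ord_maps P N).
Local Notation LE := (linear_extensions P).

Definition inj_maps : {set map_} := [set z in O | injectiveb z].
Definition draws : {set {set 'I_N.+1}} := [set A : {set 'I_N.+1} | #|A| == #|P|].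
(** Parametrizes the injective order-preserving maps by their ranks [f] and their image [A]. *)
Definition place (f : {ffun P -> 'I_#|P|}) (A : {set 'I_N.+1}) : map_ :=
  [ffun x => nth ord0 (enum A) (f x)].

Lemma linear_extensionsP (f : {ffun P -> 'I_#|P|}) : reflect
  (injective f /\ forall x y, (x <= y)%O -> (f x <= f y)%N) (f \in LE).
Proof.
rewrite inE; apply: (iffP andP) => -[h1 h2]; split.
- exact/injectiveP.
- by move=> x y; have /forallP /(_ x) /forallP /(_ y) /implyP := h2.
- exact/injectiveP.
- by apply/forallP => x; apply/forallP => y; apply/implyP/h2.
Qed.

Lemma place_lt f A x y : A \in draws -> (place f A x < place f A y)%N = (f x < f y)%N.
Proof.
rewrite inE => /eqP cA.
have szA : size (enum A) = #|P| by rewrite -cardE.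
have mono i j : (i < j < #|P|)%N -> (nth ord0 (enum A) i < nth ord0 (enum A) j)%N.
  move=> /andP [ij jn]; have tr : transitive (fun i j : 'I_N.+1 => (i < j)%N).
    by move=> b a c; exact: ltn_trans.
  apply: (sorted_ltn_nth tr ord0 (sorted_enum_ord A)); rewrite ?inE ?szA //.
  exact: ltn_trans jn.
rewrite !ffunE; case: (ltngtP (f x) (f y)) => [h|h|h].
- by rewrite mono // h ltn_ord.
- by apply/negbTE; rewrite -leqNgt ltnW // mono // h ltn_ord.
- by rewrite h ltnn.
Qed.

Lemma place_image f A : f \in LE -> A \in draws ->
  [set place f A x | x : P] = A.
Proof.
move=> /linear_extensionsP [f_inj _] hA; have pl := place_lt f _ _ hA.
move: (hA); rewrite inE => /eqP cA.
apply/eqP; rewrite eqEcard; apply/andP; split.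
  apply/subsetP => _ /imsetP [x _ ->]; rewrite ffunE -mem_enum mem_nth //.
  by rewrite -cardE cA.
rewrite card_imset ?cA // => x y e; apply: f_inj; apply: val_inj => /=.
by have := pl x y; have := pl y x; rewrite e ltnn; case: ltngtP.
Qed.

Lemma place_inj f A f' A' : f \in LE -> A \in draws -> f' \in LE -> A' \in draws ->
  place f A = place f' A' -> f = f' /\ A = A'.
Proof.
move=> hf hA hf' hA' e.
have eA : A = A' by rewrite -(place_image hf hA) -(place_image hf' hA') e.
split=> //; apply/ffunP => x; apply: val_inj => /=; apply/eqP.
have : place f A x = place f' A x by rewrite e eA.
move: hA; rewrite inE => /eqP cA; rewrite !ffunE => /eqP.
by rewrite nth_uniq ?enum_uniq // -cardE cA.
Qed.

Lemma place_mem f A : f \in LE -> A \in draws -> place f A \in inj_maps.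
Proof.
move=> hf hA; have pl := place_lt f _ _ hA.
have /linear_extensionsP [f_inj f_mono] := hf.
rewrite inE; apply/andP; split.
  by apply/ord_mapsP => x y /f_mono; rewrite leqNgt -pl -leqNgt.
apply/injectiveP => x y e; apply: f_inj; apply: val_inj => /=.
by have := pl x y; have := pl y x; rewrite e ltnn; case: ltngtP.
Qed.

Lemma place_surj z : z \in inj_maps ->
  exists f A, [/\ f \in LE, A \in draws & z = place f A].
Proof.
rewrite inE => /andP [/ord_mapsP z_mono /injectiveP z_inj].
pose A := [set z x | x : P].
have cA : #|A| = #|P| by rewrite card_imset.
have zA x : z x \in enum A by rewrite mem_enum imset_f.
have idx x : (index (z x) (enum A) < #|P|)%N by rewrite -cA cardE index_mem.
pose f : {ffun P -> 'I_#|P|} := [ffun x => Ordinal (idx x)].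
have hA : A \in draws by rewrite inE cA.
have zE : z = place f A by apply/ffunP => x; rewrite !ffunE nth_index.
have f_inj : injective f.
  move=> x y e; apply: z_inj; rewrite zE.
  by rewrite (ffunE _ x) (ffunE _ y) e.
exists f, A; split=> //; apply/linear_extensionsP; split=> // x y xy.
by rewrite leqNgt -(place_lt f _ _ hA) -leqNgt -zE z_mono.
Qed.

(** The bijection [place] makes the ranks of a uniform injective map a uniform linear extension,
    independent of the image. *)
Lemma sum_inj_maps (V : nmodType) (F : map_ -> V) :
  \sum_(z in inj_maps) F z = \sum_(f in LE) \sum_(A in draws) F (place f A).
Proof.
have -> : inj_maps = [set place p.1 p.2 | p in setX LE draws].
  apply/setP => z; apply/idP/imsetP => [/place_surj [f [A [hf hA ->]]]|[[f A]]].
    by exists (f, A); rewrite // in_setX hf hA.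
  by rewrite in_setX => /andP [hf hA] ->; exact: place_mem.
rewrite big_imset /=; last first.
  move=> [f A] [f' A']; rewrite !in_setX => /andP [hf hA] /andP [hf' hA'] /= e.
  by have [-> ->] := place_inj hf hA hf' hA' e.
by rewrite pair_big /=; apply: eq_bigl => -[f A]; rewrite in_setX.
Qed.

Lemma card_inj_maps : #|inj_maps| = (#|LE| * #|draws|)%N.
Proof.
rewrite -sum1_card (sum_inj_maps (fun=> 1%N)).
under eq_bigr => f _ do rewrite sum1_card.
by rewrite sum_nat_const.
Qed.

(** Compression with [lev x] the number of elements strictly below [x]: it is strictly increasing,
    so levels are antichains and every map qualifies. *)
Lemma all_maps_le : (N.+1 ^ #|P| <= #|P| ^ #|P| * #|O|)%N.
Proof.
have [P0|n0] := posnP #|P|.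
  by rewrite P0 !expn0 mul1n card_ord_maps_gt0.
have lev_lt (x : P) : (#|[set y | (y < x)%O]| < #|P|)%N.
  rewrite -cardsT; apply: proper_card; rewrite properE subsetT /=.
  by apply/subsetPn; exists x; rewrite ?inE // ltxx.
case E : #|P| n0 lev_lt => [//|p] _ lev_lt.
pose lev (x : P) : 'I_p.+1 := Ordinal (lev_lt x).
have lev_strict x y : (x < y)%O -> (lev x < lev y)%N.
  move=> xy; apply: proper_card; rewrite properE; apply/andP; split.
    by apply/subsetP => u; rewrite !inE => ux; exact: lt_trans xy.
  by apply/subsetPn; exists x; rewrite !inE // ltxx.
have := @compress _ P N p lev [set: map_].
rewrite E cardsT card_ffun card_ord E => h.
apply: leq_trans (h _ _) _.
- by move=> x y; rewrite le_eqVlt => /orP [/eqP -> //|/lev_strict /ltnW].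
- move=> z x y _; rewrite le_eqVlt => /orP [/eqP -> //|/lev_strict].
  by move=> + e; rewrite e ltnn.
by rewrite leq_mul2l subset_leq_card ?orbT //; apply/subsetP => z; rewrite inE => /andP [].
Qed.

(** If [z x = z y], the value at [x] can be read off at [y], so the coordinate [x] is free to store
    any of [N.+1] values. *)
Lemma card_coincide (x y : P) : x != y ->
  (N.+1 * #|[set z : map_ | z x == z y]| <= N.+1 ^ #|P|)%N.
Proof.
move=> nxy; set S := [set z | _].
pose g (p : map_ * 'I_N.+1) : map_ := upd p.1 x p.2.
have g_inj : {in setX S [set: 'I_N.+1] &, injective g}.
  move=> [z a] [z' a']; rewrite !in_setX !inE !andbT /= => /eqP hz /eqP hz' e.
  have gE (w : map_) b : w x = w y -> w = upd (g (w, b)) x (g (w, b) y).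
    move=> h; rewrite /g /= upd_upd ffunE [y == x]eq_sym (negbTE nxy) -h upd_id //.
  have -> : a = a' by have := congr1 (fun w : map_ => w x) e; rewrite !ffunE eqxx.
  by rewrite (gE z a hz) (gE z' a' hz') e.
have <- : #|{: map_}| = (N.+1 ^ #|P|)%N by rewrite card_ffun card_ord.
rewrite -[X in (X * _)%N]card_ord -cardsT mulnC -cardsX -(card_in_imset g_inj).
exact: max_card.
Qed.

(** Union bound over pairs of elements, with [all_maps_le] to compare all maps to the
    order-preserving ones. *)
Lemma card_not_injective :
  (N.+1 * #|[set z in O | ~~ injectiveb z]| <= #|P| ^ (#|P| + 2) * #|O|)%N.
Proof.
have sub : [set z in O | ~~ injectiveb z] \subset
    \bigcup_(p : P * P | p.1 != p.2) [set z : map_ | z p.1 == z p.2].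
  apply/subsetP => z; rewrite inE => /andP [_ /injectivePn [x [y nxy e]]].
  by apply/bigcupP; exists (x, y); rewrite // inE e.
apply: (@leq_trans (N.+1 * \sum_(p : P * P | p.1 != p.2) #|[set z : map_ | z p.1 == z p.2]|)).
  rewrite leq_mul2l (leq_trans (subset_leq_card sub)) ?orbT //.
  elim/big_rec2: _ => [|p m U _ IH]; first by rewrite cards0.
  by apply: leq_trans (leq_card_setU _ _) _; rewrite leq_add2l.
rewrite big_distrr /=.
apply: (@leq_trans (\sum_(p : P * P) N.+1 ^ #|P|)).
  rewrite [leqLHS]big_mkcond; apply: leq_sum => p _.
  by case: ifP => // /card_coincide.
rewrite sum_nat_const card_prod mulnn expnD [(#|P| ^ #|P| * _)%N]mulnC -mulnA.
by rewrite leq_mul2l all_maps_le orbT.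
Qed.

End Injective.

(** * From maps back to linear extensions *)

Section Transfer.
Context (R : realType) {d : Order.disp_t} (P : finPOrderType d).

Lemma prob_not_injective_small (e : R) : 0 < e ->
  exists N0, forall N, (N0 <= N)%N ->
    prob R (ord_maps P N) (fun z => ~~ injectiveb z) <= e.
Proof.
move=> e0; have [m m0 hm] := ex_inv_le e0.
exists (m * #|P| ^ (#|P| + 2))%N => N hN; apply: le_trans hm.
rewrite probE ler_pdivrMr ?ltr0n ?card_ord_maps_gt0 // mulrC ler_pdivlMr ?ltr0n //.
rewrite -natrM ler_nat -(leq_pmul2l (ltn0Sn N)).
rewrite mulnA; apply: leq_trans (leq_mul (card_not_injective P N) (leqnn m)) _.
rewrite mulnAC leq_mul2r; apply/orP; right.
by rewrite mulnC ltnW.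
Qed.

Lemma restricted_ordering_sorted (f : {ffun P -> 'I_#|P|}) (Y : {set P}) (t : seq P) :
  f \in linear_extensions P -> perm_eq t (enum Y) ->
  sorted ltn [seq nat_of_ord (f v) | v <- t] -> restricted_ordering f Y = t.
Proof.
move=> /linear_extensionsP [f_inj _] pt srt.
have tr : transitive (fun x y => (f x <= f y)%N) by move=> y x z; exact: leq_trans.
apply: (sorted_eq tr).
- by move=> x y /anti_leq /val_inj /f_inj.
- apply: sorted_filter => //; apply: sort_sorted => x y; exact: leq_total.
- by move: srt; rewrite sorted_map; apply: sub_sorted => x y /= /ltnW.
apply: uniq_perm.
- by rewrite filter_uniq // sort_uniq enum_uniq.
- by rewrite (perm_uniq pt) enum_uniq.
- by move=> x; rewrite mem_filter mem_sort mem_enum andbT (perm_mem pt) mem_enum.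
Qed.

(** Each linear extension increasing along [t] yields [#|D|] injective maps increasing along [t];
    the non-injective maps are discarded at the price of their probability. *)
Lemma linext_prob_ge (N : nat) (Y : {set P}) (t : seq P) :
  perm_eq t (enum Y) ->
  prob R (ord_maps P N) (fun z => sorted ltn [seq nat_of_ord (z v) | v <- t])
    - prob R (ord_maps P N) (fun z => ~~ injectiveb z) <=
  linext_prob R (fun f => restricted_ordering f Y == t).
Proof.
move=> pt.
set LE := linear_extensions P; set D := draws P N.
pose srt (f : {ffun P -> 'I_#|P|}) := sorted ltn [seq nat_of_ord (f v) | v <- t].
apply: (@le_trans _ _ (prob R LE srt)); last first.
  rewrite -[leRHS](probE R LE); apply: ler_prob => f fLE h.
  by rewrite (restricted_ordering_sorted fLE pt h).
rewrite lerBlDr.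
apply: (@le_trans _ _ (prob R (ord_maps P N) (fun z => (injectiveb z &&
    sorted ltn [seq nat_of_ord (z v) | v <- t]) || ~~ injectiveb z))).
  by apply: ler_prob => z _ ->; rewrite andbT orbN.
apply: (le_trans (prob_or _ _ _ _)); rewrite lerD2r.
have cE : #|[set z in ord_maps P N | injectiveb z &&
    sorted ltn [seq nat_of_ord (z v) | v <- t]]| = (#|[set f in LE | srt f]| * #|D|)%N.
  rewrite -sum1_card.
  transitivity (\sum_(z in inj_maps P N) sorted ltn [seq nat_of_ord (z v) | v <- t])%N.
    rewrite big_mkcond [RHS]big_mkcond; apply: eq_bigr => z _.
    by rewrite inE andbA [in RHS]inE; case: ifP => [/andP [-> ->]|] //; case: (_ && injectiveb z) => //= ->.
  rewrite (sum_inj_maps (fun z => nat_of_bool (sorted ltn [seq nat_of_ord (z v) | v <- t]))).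
  transitivity (\sum_(f in LE) \sum_(A in D) srt f)%N.
    apply: eq_bigr => f _; apply: eq_bigr => A hA; congr nat_of_bool.
    rewrite /srt !sorted_map; apply: eq_sorted => x y /=; exact: place_lt.
  under eq_bigr => f _ do rewrite sum_nat_const.
  rewrite -big_distrr /= mulnC; congr (_ * _)%N.
  rewrite -[RHS]sum1_card big_mkcond [RHS]big_mkcond; apply: eq_bigr => f _.
  by rewrite inE; case: (f \in LE) => //=; case: (srt f).
rewrite !probE cE.
(* [D] is empty when the chain is shorter than [P]. *)
have [D0|D0] := posnP #|D|.
  by rewrite D0 muln0 mul0r divr_ge0.
have [L0|L0] := posnP #|LE|.
  have -> : [set f in LE | srt f] = set0.
    apply/eqP; rewrite -subset0; apply/subsetP => f; rewrite inE => /andP [fL _].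
    by move: L0 => /eqP; rewrite cards_eq0 => /eqP L0; rewrite L0 in fL.
  by rewrite cards0 mul0n !mul0r.
rewrite ler_pdivrMr ?ltr0n ?card_ord_maps_gt0 // mulrAC ler_pdivlMr ?ltr0n //.
rewrite -!natrM ler_nat -mulnA leq_mul2l [(#|D| * _)%N]mulnC -card_inj_maps.
by rewrite subset_leq_card ?orbT //; apply/subsetP => z; rewrite inE => /andP [].
Qed.

Lemma delta_witness_of_maps (N k : nat) (Y : seq P) (e eps : R) :
  uniq Y -> size Y = k ->
  prob R (ord_maps P N) (fun z => ~~ injectiveb z) <= e ->
  (forall t, perm_eq t Y -> k`!%:R^-1 - eps <=
     prob R (ord_maps P N) (fun z => sorted ltn [seq nat_of_ord (z v) | v <- t])) ->
  delta_witness k [set: P] (k`!%:R^-1 - eps - e).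
Proof.
move=> uY szY he h; exists [set x in Y]; split.
- exact: subsetT.
- by rewrite cardsE (card_uniqP uY).
move=> t pt; apply: le_trans (linext_prob_ge N pt).
apply: lerB => //; apply: h; apply: perm_trans pt _.
by apply: uniq_perm; rewrite ?enum_uniq // => x; rewrite mem_enum inE.
Qed.

(** The [k!] orderings of [Y] are disjoint events, so the least likely one has probability at most
    [1/k!]. *)
Lemma delta_witness_le (k : nat) (X : {set P}) (delta : R) :
  delta_witness k X delta -> delta <= k`!%:R^-1.
Proof.
move=> [Y [_ cY h]].
have szp : size (permutations (enum Y)) = k`! by rewrite size_permutations ?enum_uniq // -cardE cY.
have k0 : 0 < k`!%:R :> R by rewrite ltr0n fact_gt0.
rewrite -[leRHS]mul1r ler_pdivlMr // mulrC -szp -sumr_cst_seq.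
apply: (@le_trans _ _ (\sum_(t <- permutations (enum Y))
    linext_prob R (fun f => restricted_ordering f Y == t))).
  by rewrite !big_seq; apply: ler_sum => t; rewrite mem_permutations => /h.
under eq_bigr => t _ do rewrite -[linext_prob _ _](probE R (linear_extensions P)).
rewrite -expect_sum; apply: le_trans (_ : prob R (linear_extensions P) predT <= _); last first.
  exact: prob_le1.
apply: ler_expect => f _; rewrite -natr_sum ler_nat.
rewrite (_ : (\sum_(t <- _) _)%N = count_mem (restricted_ordering f Y) (permutations (enum Y))).
  by rewrite count_uniq_mem ?permutations_uniq // leq_b1.
rewrite -sum1_count [RHS]big_mkcond; apply: eq_bigr => t _ /=.
by rewrite eq_sym; case: eqP.
Qed.

End Transfer.

(** * Many minimal elements of comparable scale *)

Lemma min_eltsP {d : Order.disp_t} (P : finPOrderType d) (x : P) :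
  reflect (forall y, ~~ (y < x)%O) (x \in min_elts P).
Proof. by rewrite inE; exact: forallP. Qed.

Lemma scale_le {d : Order.disp_t} (P : finPOrderType d) N (x : P) : (scale N x <= N)%N.
Proof. by apply/bigmax_leqP => t _; rewrite -ltnS. Qed.

Lemma dyadic_class (a s : nat) : (0 < a)%N -> (a <= s)%N ->
  (a * 2 ^ trunc_log 2 (s %/ a) <= s < 2 * (a * 2 ^ trunc_log 2 (s %/ a)))%N.
Proof.
move=> a0 as_; have q0 : (0 < s %/ a)%N by rewrite divn_gt0.
have /andP [h1 h2] := trunc_log_bounds (isT : (1 < 2)%N) q0.
apply/andP; split.
  by apply: leq_trans (leq_trunc_div s a); rewrite mulnC leq_mul2r h1 orbT.
apply: leq_trans (ltn_ceil s a0) _.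
by rewrite mulnCA -expnS mulnC leq_mul2l h2 orbT.
Qed.

Section Witnesses.
Variable R : realType.

(** All scales lie between about [N / (2 * #|P|)] and [N], hence in at most [(trunc_log 2 #|P|).+3]
    dyadic classes; one class contains more than [L] minimal elements. *)
Lemma min_elts_witness (k : nat) (eps : R) : 0 < eps -> exists C : nat,
  forall (d : Order.disp_t) (P : finPOrderType d),
    (C * (trunc_log 2 #|P|).+1 <= #|min_elts P|)%N -> (0 < #|P|)%N ->
    delta_witness k [set: P] (k`!%:R^-1 - eps).
Proof.
move=> eps0; have e20 : 0 < eps / 2 by rewrite divr_gt0.
have [L [S0 hL]] := minimal_family k e20.
exists (3 * L.+1)%N => d P hmin n0.
have [N0 hN0] := prob_not_injective_small P e20.
(* The chain is long enough for the lowest dyadic class to start beyond [S0]. *)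
pose N := maxn N0 (2 * (#|P| * S0.+1)).
pose u := (N.+1 %/ 2 %/ #|P|)%N.
have uS : (S0 < u)%N.
  rewrite leq_divRL // leq_divRL //.
  have : (2 * (#|P| * S0.+1) <= N)%N by exact: leq_maxr.
  by lia.
have u0 : (0 < u)%N by apply: leq_ltn_trans uS.
have uscale (x : P) : (u <= scale N x)%N.
  by apply: (scale_lower R); rewrite mulnC; exact: leq_trunc_div.
pose K := (trunc_log 2 #|P|).+3.
pose cl (x : P) := trunc_log 2 (scale N x %/ u).
have clK x : (cl x < K)%N.
  have h : (scale N x %/ u <= 2 ^ 2 * #|P|)%N.
    rewrite -ltnS ltn_divLR //; apply: leq_ltn_trans (scale_le N x) _.
    have := ltn_ceil (N.+1 %/ 2) n0; have := ltn_ceil N.+1 (isT : (0 < 2)%N).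
    rewrite -/u; move: (N.+1 %/ 2)%N => v hv hu.
    have : (u.+1 * #|P| <= 2 * u * #|P|)%N.
      by rewrite leq_mul2r mul2n -addnn -[u.+1]addn1 leq_add2l u0 orbT.
    by rewrite mulSn; nia.
  rewrite ltnS; apply: leq_trans (leq_trunc_log 2 h) _.
  have -> : (2 ^ 2 * #|P| = 2 * (2 * #|P|))%N by rewrite mulnA.
  by rewrite !trunc_logMp ?muln_gt0.
have [|c hc] := @pigeonhole_filter P 'I_K (fun x => inord (cl x)) L (enum (min_elts P)).
  rewrite card_ord -cardE; apply: leq_trans hmin.
  by rewrite /K; move: (trunc_log _ _) => q; lia.
set s := filter _ _ in hc.
have [||||Y [sub sz hY]] := hL d P N s (u * 2 ^ c)%N _ (ltnW hc).
- by rewrite filter_uniq // enum_uniq.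
- apply: leq_trans (ltnW uS) _; by rewrite leq_pmulr // expn_gt0.
- by move=> x; rewrite mem_filter mem_enum => /andP [_ /min_eltsP].
- move=> x; rewrite mem_filter => /andP [/eqP <- _].
  by rewrite inordK ?clK // dyadic_class.
have uY : uniq Y by apply: subseq_uniq sub _; rewrite filter_uniq // enum_uniq.
have := delta_witness_of_maps uY sz (hN0 N (leq_maxl _ _)) hY.
by rewrite -addrA -opprD -splitr.
Qed.

End Witnesses.

(** * Heights and random subsets of a chain *)

Section Subsets.
Local Open Scope nat_scope.

Lemma card_ord_lt (M a : nat) : a <= M -> #|[set i : 'I_M | i < a]| = a.
Proof.
move=> aM; rewrite -sum1_card.
rewrite (eq_bigl (fun i : 'I_M => i < a)); last by move=> i; rewrite inE.
by rewrite (big_ord_narrow aM) sum1_card card_ord.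
Qed.

Lemma card_ord_ge (M a : nat) : a <= M -> #|[set i : 'I_M | a <= i]| = M - a.
Proof.
move=> aM; have -> : [set i : 'I_M | a <= i] = ~: [set i : 'I_M | i < a].
  by apply/setP => i; rewrite !inE leqNgt.
by rewrite cardsCs setCK card_ord card_ord_lt.
Qed.

(** Drawing without replacement is no likelier than drawing with replacement to avoid [a] given
    points. *)
Lemma ffact_ratio M a n : a <= M -> (M - a) ^_ n * M ^ n <= M ^_ n * (M - a) ^ n.
Proof.
move=> aM; elim: n => [|n IH]; first by rewrite !ffactn0 !expn0.
rewrite !ffactnSr !expnSr.
have h : (M - a - n) * M <= (M - n) * (M - a).
  by rewrite !mulnBl; nia.
by have := leq_mul IH h; rewrite mulnACA [X in _ <= X -> _]mulnACA.
Qed.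

Lemma bernoulli_sub M a n : a <= M -> (M - a) ^ n * (M + n * a) <= M ^ n.+1.
Proof.
move=> aM; elim: n => [|n IH]; first by rewrite expn0 mul1n mul0n addn0 expn1.
apply: (@leq_trans (M * ((M - a) ^ n * (M + n * a)))).
  rewrite expnSr -mulnA [X in _ <= X]mulnCA leq_mul2l; apply/orP; right.
  by rewrite mulSn !mulnDr !mulnBl; nia.
by rewrite [X in _ <= X]expnS leq_mul2l IH orbT.
Qed.

(** A random [n]-subset misses [a] given points with probability at most
    [(1 - a/M)^n <= 1 / (1 + n * a/M) <= 1/2]. *)
Lemma bin_half M a n : 0 < M -> a <= M -> M <= n * a -> 2 * 'C(M - a, n) <= 'C(M, n).
Proof.
move=> M0 aM Mna.
have h1 : 2 * (M - a) ^ n <= M ^ n.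
  rewrite -(leq_pmul2r M0) -expnSr; apply: leq_trans (bernoulli_sub n aM).
  rewrite [2 * _]mulnC -mulnA leq_mul2l; apply/orP; right; lia.
have h2 : 'C(M - a, n) * M ^ n <= 'C(M, n) * (M - a) ^ n.
  rewrite -(leq_pmul2r (fact_gt0 n)) -mulnA [M ^ n * _]mulnC mulnA bin_ffact.
  rewrite -[X in _ <= X]mulnA [(M - a) ^ n * _]mulnC [X in _ <= X]mulnA bin_ffact.
  exact: ffact_ratio.
have Mn0 : 0 < M ^ n by rewrite expn_gt0 M0.
rewrite -(leq_pmul2r Mn0) -mulnA; apply: leq_trans (leq_mul (leqnn 2) h2) _.
by rewrite mulnCA leq_mul2l h1 orbT.
Qed.

Variables (N n : nat).
Local Notation dr := [set A : {set 'I_N.+1} | #|A| == n].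

Lemma card_drawsE : #|dr| = 'C(N.+1, n).
Proof. by rewrite card_draws card_ord. Qed.

Lemma card_draws_ge a : a <= N.+1 ->
  #|[set A in dr | A \subset [set i : 'I_N.+1 | a <= i]]| = 'C(N.+1 - a, n).
Proof.
move=> aN; rewrite -(card_ord_ge aN) -cards_draws; apply: eq_card => A.
by rewrite !inE andbC.
Qed.

Lemma card_draws_mem (v : 'I_N.+1) : 0 < n ->
  N.+1 * #|[set A in dr | v \in A]| = n * #|dr|.
Proof.
rewrite card_drawsE; case E : n => [//|m] _; rewrite -mul_bin_diag; congr (_ * _).
have := cardsID [set A : {set 'I_N.+1} | v \in A] [set A : {set 'I_N.+1} | #|A| == m.+1].
have -> : #|[set A : {set 'I_N.+1} | #|A| == m.+1] :\: [set A : {set 'I_N.+1} | v \in A]|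
    = 'C(N, m.+1).
  transitivity #|[set A : {set 'I_N.+1} | (A \subset ~: [set v]) && (#|A| == m.+1)]|.
    by apply: eq_card => A; rewrite !inE subsetC sub1set inE.
  by rewrite cards_draws cardsC1 card_ord.
rewrite card_draws card_ord binS addnC => /addnI <-.
by apply: eq_card => A; rewrite !inE.
Qed.

(* Markov's inequality for the number of elements of a random n-subset
   below a. *)
Lemma card_draws_nth_lt (r a : nat) : r < n -> a <= N.+1 ->
  #|[set A in dr | nth ord0 (enum A) r < a]| * (r.+1 * N.+1) <= a * n * #|dr|.
Proof.
move=> rn aN.
have n0 : 0 < n by apply: leq_ltn_trans rn.
apply: (@leq_trans ((\sum_(A in dr) #|[set v in A | v < a]|) * N.+1)).
  rewrite mulnA leq_mul2r; apply/orP; right.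
  rewrite -sum_nat_const big_mkcond [leqRHS]big_mkcond; apply: leq_sum => A _.
  rewrite !inE; case: eqP => //= cA; case: ifP => // hr.
  have szA : size (enum A) = n by rewrite -cardE.
  have inj : injective (fun i : 'I_r.+1 => nth ord0 (enum A) i).
    move=> i j /eqP; rewrite nth_uniq ?enum_uniq ?szA //; first by move/eqP/val_inj.
      by apply: leq_trans (ltn_ord i) _.
    by apply: leq_trans (ltn_ord j) _.
  apply: (@leq_trans #|[set nth ord0 (enum A) i | i : 'I_r.+1]|).
    by rewrite card_imset // card_ord.
  apply: subset_leq_card; apply/subsetP => _ /imsetP [i _ ->]; rewrite inE.
  have ir : i <= r by rewrite -ltnS.
  have iA : i < size (enum A) by rewrite szA; exact: leq_ltn_trans rn.
  rewrite -mem_enum mem_nth //=; apply: leq_ltn_trans hr.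
  move: ir; rewrite leq_eqVlt => /orP [/eqP -> //|ir].
  have tr : transitive (fun i j : 'I_N.+1 => i < j) by move=> b c d; exact: ltn_trans.
  by apply: ltnW; apply: (sorted_ltn_nth tr ord0 (sorted_enum_ord A)); rewrite ?inE // szA.
have -> : \sum_(A in dr) #|[set v in A | v < a]| =
    \sum_(v : 'I_N.+1 | v < a) #|[set A in dr | v \in A]|.
  transitivity (\sum_(A in dr) \sum_(v : 'I_N.+1 | v < a) (v \in A)).
    apply: eq_bigr => A _; rewrite -sum1_card big_mkcond [RHS]big_mkcond.
    by apply: eq_bigr => v _; rewrite inE andbC; case: ltnP => //= _; case: (v \in A).
  rewrite exchange_big; apply: eq_bigr => v _.
  rewrite -sum1_card big_mkcond [RHS]big_mkcond; apply: eq_bigr => A _ /=.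
  by rewrite [in RHS]inE; case: (A \in dr) => //=; case: (v \in A).
rewrite big_distrl /=.
under eq_bigr => v _ do rewrite mulnC card_draws_mem //.
rewrite sum_nat_const -mulnA; apply: eq_leq; congr (_ * _).
by rewrite -[RHS](card_ord_lt aN); apply: eq_card => v; rewrite inE.
Qed.

End Subsets.

Lemma min_elts_below {d : Order.disp_t} (P : finPOrderType d) (x : P) :
  exists2 y, y \in min_elts P & (y <= x)%O.
Proof.
have := @arg_minnP _ x (fun y => (y <= x)%O) (fun y => #|[set u | (u < y)%O]|) (lexx x).
case=> y yx ymin; exists y => //; apply/min_eltsP => u; apply/negP => uy.
have := ymin u (ltW (lt_le_trans uy yx)); rewrite leqNgt => /negP; apply.
apply: proper_card; rewrite properE; apply/andP; split.
  by apply/subsetP => v; rewrite !inE => vu; exact: lt_trans uy.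
by apply/subsetPn; exists u; rewrite !inE // ltxx.
Qed.

Section Heights.
Context (R : realType) {d : Order.disp_t} (P : finPOrderType d) (N : nat).
Local Notation O := (ord_maps P N).
Local Notation Pr := (prob R O).
Hypothesis P_gt0 : (0 < #|P|)%N.
Hypothesis mostly_inj : Pr (fun z => ~~ injectiveb z) <= 2^-1.

Lemma inj_maps_large : (#|O| <= 2 * #|inj_maps P N|)%N.
Proof.
have : 2^-1 <= Pr (fun z => injectiveb z).
  by move: mostly_inj; rewrite prob_not ?ord_maps_neq0 //; lra.
rewrite probE ler_pdivlMr ?ltr0n ?card_ord_maps_gt0 // mulrC ler_pdivrMr //.
by rewrite -natrM ler_nat mulnC.
Qed.

Lemma inj_maps_ge a : (a <= N.+1)%N -> (N.+1 <= #|P| * a)%N ->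
  (2 * #|[set z in inj_maps P N | [forall x, a <= z x]]| <= #|inj_maps P N|)%N.
Proof.
move=> aN hN; set S := [set z in _ | _].
have -> : #|S| = (#|linear_extensions P| * 'C(N.+1 - a, #|P|))%N.
  rewrite -sum1_card.
  transitivity (\sum_(z in inj_maps P N) [forall x, a <= z x]%N : nat)%N.
    rewrite big_mkcond [RHS]big_mkcond; apply: eq_bigr => z _.
    by rewrite [in LHS]inE; case: (z \in _) => //=; case: [forall x, _].
  rewrite (sum_inj_maps (fun z : {ffun P -> 'I_N.+1} => nat_of_bool [forall x, a <= z x]%N)).
  rewrite -sum_nat_const; apply: eq_bigr => f hf.
  rewrite -(card_draws_ge #|P| aN) -sum1_card.
  rewrite big_mkcond [RHS]big_mkcond; apply: eq_bigr => A _.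
  rewrite [in RHS]inE -/(draws P N); case: (boolP (A \in draws P N)) => //= hA.
  have -> : [forall x, a <= place f A x]%N = (A \subset [set i : 'I_N.+1 | (a <= i)%N]).
    rewrite -[in RHS](place_image hf hA); apply/forallP/subsetP => [h _ /imsetP [x _ ->]|h x].
      by rewrite inE.
    by have := h _ (imset_f _ (isT : x \in predT)); rewrite inE.
  by case: (_ \subset _).
rewrite card_inj_maps /draws card_drawsE mulnCA leq_mul2l; apply/orP; right.
exact: bin_half.
Qed.

(** At least half of the maps are injective, and at least half of these take a value below [a],
    hence do so at a minimal element; a union bound concludes. *)
Lemma prob_minimal_lt a : (a <= N.+1)%N -> (N.+1 <= #|P| * a)%N ->
  4^-1 <= \sum_(x in min_elts P) Pr (fun z => z x < a)%N.
Proof.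
move=> aN hN.
rewrite -(expect_sum O _ _ (fun x z => (z x < a)%N%:R)).
apply: (@le_trans _ _ (Pr (fun z => injectiveb z && ~~ [forall x, a <= z x]%N))).
  rewrite probE ler_pdivlMr ?ltr0n ?card_ord_maps_gt0 // mulrC ler_pdivrMr //.
  rewrite -natrM ler_nat.
  have h1 := inj_maps_large; have h2 := inj_maps_ge aN hN.
  have := cardsID [set z : {ffun P -> 'I_N.+1} | [forall x, a <= z x]%N] (inj_maps P N).
  have -> : inj_maps P N :&: [set z : {ffun P -> 'I_N.+1} | [forall x, (a <= z x)%N]] =
      [set z in inj_maps P N | [forall x, (a <= z x)%N]].
    by apply/setP => z; rewrite in_setI [RHS]inE; congr (_ && _); rewrite inE.
  have -> : inj_maps P N :\: [set z : {ffun P -> 'I_N.+1} | [forall x, (a <= z x)%N]] =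
      [set z in O | injectiveb z && ~~ [forall x, (a <= z x)%N]].
    by apply/setP => z; rewrite in_setD [RHS]inE andbA andbC; congr (_ && _); rewrite inE.
  have key p q i o : (o <= 2 * i -> 2 * p <= i -> p + q = i -> o <= q * 4)%N by lia.
  exact: key h1 h2.
apply: ler_expect => z /ord_mapsP zO; rewrite -natr_sum ler_nat.
case: injectiveb => //=; case: (boolP [forall x, _]) => //= /forallPn [x].
rewrite -ltnNge => hx; have [y ymin yx] := min_elts_below x.
by rewrite (bigD1 y) //= (leq_ltn_trans (zO _ _ yx) hx).
Qed.

(** With [s] one above the scale, [z x] is at most [s] times the number of [j] with [j * s <= z x],
    and these events have probability at most [2^-j]. *)
Lemma expect_le_scale x : expect O (fun z => (z x)%:R) <= 2 * (scale N x).+1%:R :> R.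
Proof.
set s := (scale N x).+1.
apply: (@le_trans _ _ (expect O (fun z => s%:R * \sum_(j < N.+1) (j * s <= z x)%N%:R))).
  apply: ler_expect => z _; rewrite -natr_sum -natrM ler_nat.
  apply: (@leq_trans (s * (z x %/ s).+1)); first by rewrite mulnC ltnW // ltn_ceil.
  rewrite leq_mul2l; apply/orP; right.
  have zN : ((z x %/ s).+1 <= N.+1)%N by rewrite ltnS (leq_trans (leq_div _ _)) // -ltnS.
  rewrite -[X in (X <= _)%N](card_ord_lt zN) -sum1_card big_mkcond; apply: leq_sum => j _.
  by rewrite inE ltnS leq_divRL //; case: (_ <= _)%N.
rewrite expectZ expect_sum mulrC ler_wpM2r //.
apply: (@le_trans _ _ (\sum_(j < N.+1) 2^-1 ^+ j)).
  by apply: ler_sum => j _; exact: prob_ge_scale.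
have geo M : \sum_(j < M) 2^-1 ^+ j = 2 - 2 * 2^-1 ^+ M :> R.
  elim: M => [|M IH]; first by rewrite big_ord0 expr0; ring.
  by rewrite big_ord_recr /= IH exprSr; field.
by rewrite geo gerBl mulr_ge0 ?exprn_ge0 ?invr_ge0.
Qed.

(** By the Markov bound, the element of rank [f x] in a uniform image is at least [a] with
    probability at least [1/2]; the [- 1] pays for rounding in [a]. *)
Lemma sum_place_ge (f : {ffun P -> 'I_#|P|}) (x : P) :
  ((f x).+1%:R * (N.+1%:R / (2 * #|P|%:R)) - 1) * (#|draws P N|%:R / 2) <=
    \sum_(A in draws P N) (place f A x)%:R :> R.
Proof.
pose a := (((f x).+1 * N.+1) %/ (2 * #|P|))%N.
have n2 : (0 < 2 * #|P|)%N by rewrite muln_gt0.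
have a1 : (a * (2 * #|P|) <= (f x).+1 * N.+1)%N by exact: leq_trunc_div.
have a2 : ((f x).+1 * N.+1 < a.+1 * (2 * #|P|))%N by rewrite ltn_ceil.
have aN : (a <= N.+1)%N.
  rewrite -(leq_pmul2r P_gt0); apply: leq_trans (_ : (f x).+1 * N.+1 <= _)%N.
    by apply: leq_trans a1; rewrite leq_mul2l leq_pmull ?orbT.
  by rewrite mulnC leq_mul2l ltn_ord orbT.
have half : (2 * #|[set A in draws P N | (place f A x < a)%N]| <= #|draws P N|)%N.
  have := card_draws_nth_lt (ltn_ord (f x)) aN; rewrite -/(draws P N).
  have -> : [set A in draws P N | (nth ord0 (enum A) (f x) < a)%N] =
      [set A in draws P N | (place f A x < a)%N].
    by apply/setP => A; rewrite [LHS]inE [RHS]inE ffunE.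
  set K := #|[set A in _ | _]|; set D := #|draws P N| => h.
  have pos : (0 < (f x).+1 * N.+1)%N by [].
  rewrite -(leq_pmul2r pos) -mulnA.
  apply: leq_trans (leq_mul (leqnn 2) h) _.
  by rewrite [leqRHS]mulnC !mulnA leq_mul2r -mulnA mulnCA a1 orbT.
apply: (@le_trans _ _ (a%:R * (#|draws P N|%:R / 2))).
  rewrite ler_wpM2r ?divr_ge0 // lerBlDr mulrA ler_pdivrMr ?mulr_gt0 ?ltr0n //.
  by rewrite natr1 -!natrM ler_nat ltnW.
apply: (@le_trans _ _ (\sum_(A in draws P N) (a * (a <= place f A x))%N%:R)); last first.
  by apply: ler_sum => A _; rewrite ler_nat; case: (leqP a (place f A x)); rewrite ?muln1 ?muln0.
rewrite -natr_sum -big_distrr /= natrM ler_wpM2l // ler_pdivrMr // -natrM ler_nat.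
have : (#|draws P N| = \sum_(A in draws P N) (a <= place f A x) +
    #|[set A in draws P N | (place f A x < a)%N]|)%N.
  rewrite -[#|[set A in _ | _]|]sum1_card [X in (_ + X)%N](_ : _ =
    \sum_(A in draws P N) (place f A x < a))%N; last first.
    rewrite big_mkcond [RHS]big_mkcond; apply: eq_bigr => A _.
    by rewrite [in LHS]inE; case: (A \in draws P N) => //=; case: (_ < _)%N.
  rewrite -big_split /= -sum1_card; apply: eq_bigr => A _.
  by case: leqP.
have key p q m : (m = p + q -> 2 * q <= m -> m <= p * 2)%N by lia.
by move=> e; exact: key e half.
Qed.

(** Averaging [sum_place_ge] over linear extensions shows that [z x] has mean at least [w/2] over
    injective maps. These are at least half of all maps, so for [w > 0] the overall mean is at least
    [w/4], while [expect_le_scale] bounds it above. *)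
Lemma height_le_scale (x : P) :
  height R x * (N.+1%:R / #|P|%:R) <= 16 * (scale N x)%:R + 18.
Proof.
set LE := linear_extensions P.
have I0 : (0 < #|inj_maps P N|)%N.
  by have := inj_maps_large; have := card_ord_maps_gt0 P N; lia.
have L0 : (0 < #|LE|)%N by move: I0; rewrite card_inj_maps muln_gt0 => /andP [].
have LR : 0 < #|LE|%:R :> R by rewrite ltr0n.
have PR : 0 < #|P|%:R :> R by rewrite ltr0n.
have OR : 0 < #|O|%:R :> R by rewrite ltr0n card_ord_maps_gt0.
pose w : R := height R x * (N.+1%:R / (2 * #|P|%:R)) - 1.
have sumI : w * (#|inj_maps P N|%:R / 2) <= \sum_(z in inj_maps P N) (z x)%:R.
  rewrite (sum_inj_maps (fun z : {ffun P -> 'I_N.+1} => (z x)%:R : R)).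
  apply: (@le_trans _ _ (\sum_(f in LE) ((f x).+1%:R * (N.+1%:R / (2 * #|P|%:R)) - 1) *
     (#|draws P N|%:R / 2))); last by apply: ler_sum => f _; exact: sum_place_ge.
  rewrite -mulr_suml sumrB -mulr_suml sumr_const card_inj_maps natrM.
  rewrite -(divfK (lt0r_neq0 LR) (\sum_(f in LE) _)) -/(height R x) /w.
  by rewrite le_eqVlt; apply/orP; left; apply/eqP; move: (height R x) => h; field; rewrite gt_eqF.
have w8 : w <= 8 * (scale N x).+1%:R.
  have [w0|w0] := leP w 0; first by apply: le_trans w0 _; rewrite mulr_ge0.
  have h1 : w * (#|O|%:R / 4) <= \sum_(z in O) (z x)%:R.
    apply: (@le_trans _ _ (w * (#|inj_maps P N|%:R / 2))).
      rewrite ler_pM2l //; have := inj_maps_large; rewrite -(ler_nat R) natrM; lra.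
    apply: le_trans sumI _; rewrite [leRHS](big_setID (inj_maps P N)) /=.
    have -> : O :&: inj_maps P N = inj_maps P N.
      by apply/setIidPr; apply/subsetP => z; rewrite inE => /andP [].
    by rewrite lerDl sumr_ge0.
  have := expect_le_scale x; rewrite /expect ler_pdivrMr // => h2.
  have : w / 4 <= 2 * (scale N x).+1%:R.
    by rewrite -(ler_pM2r OR); apply: le_trans h2; apply: le_trans h1; rewrite mulrAC mulrA.
  lra.
have -> : height R x * (N.+1%:R / #|P|%:R) = 2 * (w + 1).
  by rewrite /w; move: (height R x) => h; field; rewrite gt_eqF.
by move: w8; rewrite -natr1; lra.
Qed.

End Heights.

(** * The case of large heights *)

Section HeightWitness.
Variable R : realType.

Lemma sum_dyadic_tail (i0 K : nat) :
  \sum_(i < K | (i0 <= i)%N) 2^-1 ^+ i <= 2 * 2^-1 ^+ i0 :> R.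
Proof.
suff : (i0 <= K)%N -> \sum_(i < K | (i0 <= i)%N) 2^-1 ^+ i = 2 * 2^-1 ^+ i0 - 2 * 2^-1 ^+ K :> R.
  have [h /(_ isT) ->|h _] := leqP i0 K.
    by rewrite gerBl mulr_ge0 ?exprn_ge0 ?invr_ge0.
  rewrite big1 ?mulr_ge0 ?exprn_ge0 ?invr_ge0 // => i hi.
  by have := ltn_ord i; lia.
elim: K => [|K IH]; first by rewrite leqn0 => /eqP ->; rewrite big_ord0; ring.
rewrite leq_eqVlt => /orP [/eqP ->|h].
  rewrite big1 ?subrr // => i hi; by have := ltn_ord i; lia.
rewrite ltnS in h; rewrite big_mkcond big_ord_recr /= -big_mkcond /= (IH h) h exprSr.
by field.
Qed.

(** All scales are at least [a * 2^i0]. If every dyadic class had at most [L] minimal elements, the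
    probabilities of [z x < a] over minimal [x] would sum to at most [2 * L / 2^i0 < 1/4], against
    [prob_minimal_lt]. *)
Lemma min_height_witness (k : nat) (eps : R) : 0 < eps -> exists H : R,
  forall (d : Order.disp_t) (P : finPOrderType d),
    H <= min_height P R -> delta_witness k [set: P] (k`!%:R^-1 - eps).
Proof.
move=> eps0; have e20 : 0 < eps / 2 by rewrite divr_gt0.
have [L [S0 hL]] := minimal_family k e20.
pose i0 := (8 * L + 1)%N.
(* As [a] is at most twice [N.+1 / #|P|], doubling [height_le_scale] gives
   [height * a <= 32 * scale + 36]; since [a >= 1], this threshold yields [a * 2^i0 <= scale]. *)
exists (32 * 2 ^+ i0 + 36) => d P hH.
have n0 : (0 < #|P|)%N.
  rewrite lt0n; apply: contraTneq hH => P0; rewrite -ltNge.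
  rewrite /min_height (eq_bigl pred0) => [|x]; last first.
    by have := max_card (pred1 x); rewrite P0 card1.
  by rewrite big_pred0_eq P0 addr_gt0 // mulr_gt0 ?exprn_gt0.
have hx (x : P) : 32 * 2 ^+ i0 + 36 <= height R x.
  by apply: le_trans hH _; rewrite /min_height; exact: bigmin_le_cond.
(* The bound [eps / 2] serves the transfer to linear extensions, [1/2] the lemmas on heights. *)
have half0 : 0 < Num.min (eps / 2) 2^-1 :> R by rewrite lt_min e20 invr_gt0 ltr0n.
have [N0 hN0] := prob_not_injective_small P half0.
pose N := maxn N0 (#|P| * S0.+1).
have := hN0 N (leq_maxl _ _); rewrite le_min => /andP [inj_e inj_h].
have NP : (#|P| * S0.+1 <= N)%N by exact: leq_maxr.
pose a := (N %/ #|P|).+1.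
have Na : (N.+1 <= #|P| * a)%N by rewrite mulnC ltn_ceil.
have aN : (a <= N.+1)%N by rewrite ltnS leq_div.
have aS : (S0 < a)%N by rewrite ltnS leq_divRL // (leq_trans _ NP) // mulnC leq_mul2l leqnSn orbT.
have PR : 0 < #|P|%:R :> R by rewrite ltr0n.
have aR : a%:R <= 2 * (N.+1%:R / #|P|%:R) :> R.
  rewrite mulrA ler_pdivlMr // -!natrM ler_nat /a mulSn.
  have h1 : (N %/ #|P| * #|P| <= N)%N by exact: leq_trunc_div.
  have h2 : (#|P| <= N)%N by apply: leq_trans NP; rewrite leq_pmulr.
  by rewrite mul2n -addnn leq_add // leqW.
have scale_a (x : P) : (a * 2 ^ i0 <= scale N x)%N.
  have h := height_le_scale n0 inj_h x.
  have h1 : (32 * 2 ^+ i0 + 36) * a%:R <= 32 * (scale N x)%:R + 36 :> R.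
    apply: (@le_trans _ _ (height R x * a%:R)); first by rewrite ler_wpM2r.
    apply: (@le_trans _ _ (height R x * (2 * (N.+1%:R / #|P|%:R)))).
      rewrite ler_wpM2l //; apply: le_trans (hx x); by rewrite addr_ge0 // mulr_ge0 // exprn_ge0.
    by rewrite mulrCA; lra.
  have a1 : 1 <= a%:R :> R by rewrite ler1n.
  rewrite -(ler_nat R) natrM natrX.
  by move: h1; rewrite mulrDl; lra.
have a0 : (0 < a)%N by [].
have asc (x : P) : (a <= scale N x)%N.
  by apply: leq_trans (scale_a x); rewrite leq_pmulr // expn_gt0.
pose cl (x : P) := trunc_log 2 (scale N x %/ a).
have clN x : (cl x < N.+1)%N.
  rewrite ltnS; apply: leq_trans (scale_le N x).
  have /andP [h _] := dyadic_class a0 (asc x).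
  apply: leq_trans h; apply: leq_trans (leq_pmull _ a0).
  exact: ltnW (ltn_expl _ _).
have cli x : (i0 <= cl x)%N.
  by apply: trunc_log_max => //; rewrite leq_divRL // mulnC.
have plt x : prob R (ord_maps P N) (fun z => z x < a)%N <= 2^-1 ^+ cl x.
  rewrite exprVn -[leRHS]mul1r ler_pdivlMr ?exprn_gt0 // mulrC -natrX.
  apply: prob_lt_scale; rewrite mulnC.
  by have /andP [] := dyadic_class a0 (asc x).
have [c hc] : exists c : 'I_N.+1, (L < #|[set x in min_elts P | cl x == c]|)%N.
  apply/existsP; rewrite -[X in is_true X]negbK negb_exists; apply/negP => /forallP small.
  have := prob_minimal_lt n0 inj_h aN Na; apply/negP; rewrite -ltNge.
  apply: (@le_lt_trans _ _ (\sum_(x in min_elts P) 2^-1 ^+ cl x)).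
    by apply: ler_sum => x _; exact: plt.
  rewrite (partition_big (fun x => inord (cl x) : 'I_N.+1) (fun i : 'I_N.+1 => (i0 <= i)%N)) /=; last first.
    by move=> x _; rewrite inordK.
  apply: (@le_lt_trans _ _ (\sum_(i < N.+1 | (i0 <= i)%N) L%:R * 2^-1 ^+ i)).
    apply: ler_sum => i _.
    rewrite (eq_bigr (fun=> 2^-1 ^+ i)) => [|x /andP [_ /eqP <-]]; last by rewrite inordK.
    rewrite sumr_const -(mulr_natl (2^-1 ^+ i)) ler_wpM2r ?exprn_ge0 ?invr_ge0 // ler_nat.
    have := small i; rewrite -leqNgt; apply: leq_trans; apply: eq_leq.
    apply: eq_card => x; rewrite [RHS]inE unfold_in; congr (_ && _).
    by rewrite -val_eqE /= inordK.
  rewrite -mulr_sumr.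
  apply: (@le_lt_trans _ _ (L%:R * (2 * 2^-1 ^+ i0))).
    by rewrite ler_wpM2l // sum_dyadic_tail.
  have h : (8 * L)%:R < 2 ^+ i0 :> R.
    by rewrite -natrX ltr_nat; apply: ltn_trans (ltn_expl i0 (isT : (1 < 2)%N)); rewrite /i0 addn1.
  rewrite exprVn mulrA ltr_pdivrMr ?exprn_gt0 // [ltRHS]mulrC ltr_pdivlMr //.
  by move: h; rewrite natrM; lra.
pose s := enum [set x in min_elts P | cl x == c].
have sE x : x \in s -> x \in min_elts P /\ cl x = c.
  by rewrite mem_enum inE => /andP [h /eqP].
have [||||Y [sub sz hY]] := hL d P N s (a * 2 ^ c)%N (enum_uniq _).
- by rewrite -cardE ltnW.
- by apply: leq_trans (ltnW aS) _; rewrite leq_pmulr // expn_gt0.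
- by move=> x /sE [/min_eltsP].
- by move=> x /sE [_ <-]; exact: dyadic_class.
have uY : uniq Y by exact: subseq_uniq sub (enum_uniq _).
have := delta_witness_of_maps uY sz inj_e hY.
by rewrite -addrA -opprD -splitr.
Qed.

End HeightWitness.

(** * The case of large width *)

Lemma width_witness (R : realType) (k : nat) (eps c : R) : 0 < eps -> 0 < c ->
  exists n0 : nat, forall (d : Order.disp_t) (P : finPOrderType d),
    (n0 <= #|P|)%N -> c * #|P|%:R <= (width P)%:R ->
    delta_witness k [set: P] (k`!%:R^-1 - eps).
Proof.
move=> eps0 c0; have e20 : 0 < eps / 2 by rewrite divr_gt0.
have [n0 [N0 h]] := antichain_family k e20 c0.
exists n0 => d P hn hw.
have [|A acA wA] := @eq_bigmax_cond _ [pred A : {set P} | antichain A] (fun A => #|A|).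
  by apply/card_gt0P; exists set0; rewrite inE; apply/forallP => x; rewrite inE.
have wE : width P = #|A| by rewrite -wA; apply: eq_bigl => B; rewrite inE.
have [N1 hN1] := prob_not_injective_small P e20.
rewrite wE in hw.
have [Y [uY sz hY]] := h d P A (maxn N0 N1) acA hw hn (leq_maxl _ _).
have := delta_witness_of_maps uY sz (hN1 _ (leq_maxr _ _)) hY.
by rewrite -addrA -opprD -splitr.
Qed.

(* Passage to the limit *)
From mathcomp Require Import all_classical all_reals all_analysis.
Import numFieldNormedType.Exports.
Local Open Scope classical_set_scope.

(** [1/k!] bounds every witness from above, so witnesses close to it suffice; they also make the set
    under the supremum nonempty. *)
Lemma delta_cvg (R : realType) (k : nat) (d : Order.disp_t)
    (P : nat -> finPOrderType d) :
  (forall eps : R, 0 < eps ->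
     \forall m \near \oo, delta_witness k [set: P m]%SET (k`!%:R^-1 - eps)) ->
  (fun m => delta_ R k [set: P m]%SET) @ \oo --> (k`!%:R^-1 : R).
Proof.
move=> h; apply/cvgrPdist_le => eps eps0; near=> m.
have w : delta_witness k [set: P m]%SET (k`!%:R^-1 - eps) by near: m; exact: h.
have ub : ubound [set delta | delta_witness k [set: P m]%SET delta] (k`!%:R^-1 : R).
  by move=> delta /=; exact: delta_witness_le.
have h1 : delta_ R k [set: P m]%SET <= k`!%:R^-1.
  by apply: ge_sup => //; exists (k`!%:R^-1 - eps).
have h2 : k`!%:R^-1 - eps <= delta_ R k [set: P m]%SET.
  by apply: ub_le_sup => //; exists (k`!%:R^-1).
by rewrite ger0_norm ?subr_ge0 // lerBlDr -lerBlDl.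
Unshelve. all: by end_near. Qed.

(** Converts the count of dyadic classes to the natural logarithm; for [n >= 2] the binary logarithm
    is at least 1 and absorbs the successor. *)
Lemma trunc_log_ln (R : realType) (n : nat) : (1 < n)%N ->
  (trunc_log 2 n).+1%:R <= 2 / ln 2 * ln (n%:R : R).
Proof.
move=> n1; have ln2 : 0 < ln (2 : R) by rewrite ln_gt0 // ltr1n.
have n0 : (0 < n)%N by exact: ltnW.
have t1 : (0 < trunc_log 2 n)%N by rewrite trunc_log_gt0.
have h : (trunc_log 2 n)%:R * ln 2 <= ln (n%:R : R).
  rewrite mulr_natl -lnXn // ler_ln ?posrE ?exprn_gt0 ?ltr0n // -natrX ler_nat.
  exact: trunc_logP.
rewrite mulrAC ler_pdivlMr // -natr1.
have : 1 <= (trunc_log 2 n)%:R :> R by rewrite ler1n.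
by move=> ?; nra.
Qed.

Theorem theorem1p5 (R : realType) (k : nat) (k_gt0 : (0 < k)%N)
    (d : Order.disp_t) (P : nat -> finPOrderType d)
    (hP :
      [\/ ((fun m => #|P m|%:R : R) @ \oo --> +oo) /\
          ((fun m => #|min_elts (P m)|%:R / ln (#|P m|%:R : R)) @ \oo --> +oo),
          (fun m => min_height (P m) R) @ \oo --> +oo
        | ((fun m => #|P m|%:R : R) @ \oo --> +oo) /\
          (exists2 c : R, 0 < c &
             forall m, c * #|P m|%:R <= (width (P m))%:R)]) :
  (fun m => delta_ R k [set: P m]%SET) @ \oo --> (k`!%:R^-1 : R).
Proof.
apply: delta_cvg => eps eps0.
case: hP => [[/cvgryPge hn /cvgryPge hmin]|/cvgryPge hh|[/cvgryPge hn [c c0 hw]]].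
- have [C hC] := min_elts_witness k eps0.
  near=> m.
  have n2 : (1 < #|P m|)%N by rewrite -(ler_nat R); near: m; exact: hn.
  have ln0 : 0 < ln (#|P m|%:R : R) by rewrite ln_gt0 // ltr1n.
  apply: hC; last exact: ltnW.
  have : C%:R * (2 / ln 2) <= #|min_elts (P m)|%:R / ln (#|P m|%:R : R).
    by near: m; exact: hmin.
  rewrite ler_pdivlMr // -mulrA -(ler_nat R) natrM; apply: le_trans.
  by rewrite ler_wpM2l // trunc_log_ln.
- have [H hH] := min_height_witness k eps0.
  by near=> m; apply: hH; near: m; exact: hh.
- have [n0 h] := width_witness k eps0 c0.
  near=> m; apply: h; last exact: hw.
  by rewrite -(ler_nat R); near: m; exact: hn.
Unshelve. all: by end_near. Qed.
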